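(* Assume $p(0,0)=0$ and $\mathbf d\in\mathbf X$, and let $\mathbf m$ be the configuration given by $$\mathbf m(i)=\sum_{j\in\mathbb Z^d}\mathrm K(i,j)\,\mathbf d(j)\qquad\text{for all } i\in\mathbb Z^d .$$ Then $\mathbf m$ minimizes the Hamiltonian $H$, and the delta measure concentrating mass on $\mathbf m$ is the unique ground state in $\mathbf X$.
   Context: Fix $d\ge1$, a norm $|\cdot|$ on $\mathbb Z^d$, and $\alpha\in(0,1)$. Let $P=(p(i,j))_{i,j\in\mathbb Z^d}$ be a space-homogeneous, finite-range, symmetric stochastic matrix: $p(i,j)\ge0$, $\sum_jp(i,j)=1$, $p(i,i+j)=p(0,j)$, $p(i,j)=p(j,i)$, and $p(0,j)=0$ if $|j|\ge R$, where $R>0$ is fixed. Let $$\mathbf X=\Big\{\mathbf x\in\mathbb R^{\mathbb Z^d}:\ \sum_{j\in\mathbb Z^d}|\mathbf x(j)|\,\alpha^{|j|/R}<\infty\Big\}.$$ $\mathbf d\in\mathbb R^{\mathbb Z^d}$ is a fixed configuration (the data). $\mathrm K(i,j)$ is the probability that the continuous-time random walk on $\mathbb Z^d$ with jump rates $\alpha p(\cdot,\cdot)$, killed at rate $1-\alpha$, is killed at site $j$ when starting at site $i$. For finite $\Lambda\subset\mathbb Z^d$, $$H_\Lambda(\mathbf x)=\sum_{\{i,j\}\not\subset\Lambda^c}\alpha p(i,j)(\mathbf x(i)-\mathbf x(j))^2+(1-\alpha)\sum_{i\in\Lambda}(\mathbf x(i)-\mathbf d(i))^2,$$ the first sum being over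 unordered pairs of sites. $\mathbf x_\Lambda\mathbf y_{\Lambda^c}$ denotes the configuration equal to $\mathbf x$ on $\Lambda$ and to $\mathbf y$ on $\Lambda^c$. $H=H_{\mathbb Z^d}$ is only a formal sum; if $\tilde{\mathbf x}$ differs from $\mathbf x$ exactly on a finite set contained in $\Lambda$, $H(\tilde{\mathbf x})-H(\mathbf x)$ is defined as $H_\Lambda(\tilde{\mathbf x}_\Lambda\mathbf x_{\Lambda^c})-H_\Lambda(\mathbf x_\Lambda\mathbf x_{\Lambda^c})$. A configuration $\mathbf x$ minimizes $H$ if $H(\tilde{\mathbf x})-H(\mathbf x)>0$ for every $\tilde{\mathbf x}\ne\mathbf x$ that differs from $\mathbf x$ on a finite set of sites. The zero-temperature ($\beta=\infty$) specification $\mu^\infty_\Lambda(\cdot|\mathbf y_{\Lambda^c})$ is the measure concentrating mass on the configuration $\mathbf x_\Lambda\in\mathbb R^\Lambda$ minimizing $\mathbf x_\Lambda\mapsto H_\Lambda(\mathbf x_\Lambda\mathbf y_{\Lambda^c})$. A ground state in $\mathbf X$ is a probability measure $\mu$ concentrated on $\mathbf X$ such that for every finite $\Lambda$, the conditional law of $\mathbf x_\Lambda$ given $\mathbf x_{\Lambda^c}=\mathbf y_{\Lambda^c}$ is $\mu^\infty_\Lambda(\cdot|\mathbf y_{\Lambda^c})$ for $\mu$-almost all $\mathbf y$. *)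

(* Defs.v *)
From HB Require Import structures.
From mathcomp Require Import all_boot all_order all_algebra finmap.
From mathcomp Require Import all_classical all_reals all_analysis measurable_realfun.

Set Implicit Arguments.
Unset Strict Implicit.
Unset Printing Implicit Defensive.

Import Order.TTheory GRing.Theory Num.Theory.
Import numFieldNormedType.Exports.

Local Open Scope classical_set_scope.
Local Open Scope ring_scope.

Notation site d := 'rV[int]_d.
Definition configuration (d : nat) (R : Type) := site d -> R.

(* A norm on Z^d is the restriction of a norm on R^d. Imposing the axioms on
   Z^d only would also admit |a + b sqrt 2| on Z^2, whose balls are infinite. *)
Record is_norm (R : realType) (d : nat) (N : 'rV[R]_d -> R) : Prop := IsNorm {
  norm_separated : forall v, N v = 0 -> v = 0 ;
  norm_homogeneous : forall (a : R) v, N (a *: v) = `|a| * N v ;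
  norm_subadditive : forall u v, N (u + v) <= N u + N v }.

Definition site_norm (R : realType) (d : nat) (N : 'rV[R]_d -> R)
  (j : site d) : R := N (map_mx intr j).

Record is_jump_matrix (R : realType) (d : nat) (N : 'rV[R]_d -> R) (rho : R)
    (p : site d -> site d -> R) : Prop := IsJumpMatrix {
  jump_ge0 : forall i j, 0 <= p i j ;
  jump_stochastic :
    forall i, (\esum_(j in [set: site d]) (p i j)%:E = 1)%E ;
  jump_homogeneous : forall i j, p i (i + j) = p 0 j ;
  jump_symmetric : forall i j, p i j = p j i ;
  jump_finite_range : forall j, rho <= site_norm N j -> p 0 j = 0 }.

Definition in_X (R : realType) (d : nat) (N : 'rV[R]_d -> R) (alpha rho : R) :
    set (configuration d R) :=
  [set x | (\esum_(j in [set: site d])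
     (`|x j| * alpha `^ (site_norm N j / rho))%:E < +oo)%E].

(* Continuous-time walk with killing: the Markov jump process on
   Z^d + cemetery, the cemetery being [None], given by its successive states
   [Y n] and the holding times [S n] in them. *)
Section killed_walk.
Context (R : realType) (d : nat).

Definition walk_rate (alpha : R) (p : site d -> site d -> R)
    (a b : option (site d)) : R :=
  match a, b with
  | Some i, Some j => alpha * p i j
  | Some _, None => 1 - alpha
  | None, _ => 0
  end.

Definition exit_rate (alpha : R) (p : site d -> site d -> R)
    (a : option (site d)) : R :=
  fine (\esum_(b in [set: option (site d)]) (walk_rate alpha p a b)%:E)%E.

Definition jump_prob (alpha : R) (p : site d -> site d -> R)
    (a b : option (site d)) : R :=
  if a is None then (b == None)%:R
  else walk_rate alpha p a b / exit_rate alpha p a.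

(* [Pr i] is the law of the walk started at [i]. [walk_law] says that [Y] is,
   under [Pr i], the Markov chain with transition matrix [jump_prob] and that,
   given [Y], the holding times are independent, the k-th one exponential of
   parameter [exit_rate (Y k)]; in the cemetery this parameter is 0 and the
   holding time is infinite. *)
Record is_killed_walk (dW : measure_display) (W : measurableType dW)
    (alpha : R) (p : site d -> site d -> R) (Pr : site d -> probability W R)
    (Y : nat -> W -> option (site d)) (S : nat -> W -> \bar R) : Prop :=
  IsKilledWalk {
  walk_state_measurable : forall n a, measurable [set w | Y n w = a] ;
  walk_time_measurable : forall n, measurable_fun [set: W] (S n) ;
  walk_time_gt0 : forall n w, (0 < S n w)%E ;
  walk_law : forall (i : site d) (n : nat) (a : nat -> option (site d))
      (t : nat -> R), (forall k, 0 <= t k) ->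
    Pr i [set w | (forall k, (k <= n)%N -> Y k w = a k) /\
                  (forall k, (k < n)%N -> ((t k)%:E < S k w)%E)] =
    ((a 0%N == Some i)%:R *
     \prod_(k < n) (jump_prob alpha p (a k) (a k.+1) *
                    expR (- (exit_rate alpha p (a k) * t k))))%:E }.

Definition walk_at (W : Type) (Y : nat -> W -> option (site d))
    (S : nat -> W -> \bar R) (w : W) (t : R) (a : option (site d)) : Prop :=
  exists n, [/\ (\sum_(k < n) S k w <= t%:E)%E,
    (t%:E < \sum_(k < n.+1) S k w)%E & Y n w = a].

(* The walk is in the cemetery at some time and at [j] just before. *)
Definition killed_at (W : Type) (Y : nat -> W -> option (site d))
    (S : nat -> W -> \bar R) (j : site d) : set W :=
  [set w | exists2 t : R, walk_at Y S w t None &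
     \forall s \near t^'-, walk_at Y S w s (Some j)].

Definition kill_prob (dW : measure_display) (W : measurableType dW)
    (Pr : site d -> probability W R) (Y : nat -> W -> option (site d))
    (S : nat -> W -> \bar R) (i j : site d) : R :=
  fine (Pr i (killed_at Y S j)).

End killed_walk.

(* Only meaningful when the family is summable (absolutely) *)
Definition family_sum (R : realType) (I : choiceType) (f : I -> R) : R :=
  fine (\esum_(i in [set: I]) ((EFin \o f)^\+ i) -
        \esum_(i in [set: I]) ((EFin \o f)^\- i))%E.

Section hamiltonian.
Context (R : realType) (d : nat).
Variables (alpha : R) (p : site d -> site d -> R) (data : configuration d R).

(* Each unordered pair {i,j} is counted as (i,j) and (j,i), whence the factor
   1/2; diagonal terms vanish. The finite range of [p] makes the support of the
   first sum finite. *)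
Definition hamiltonian (L : {fset (site d)}) (x : configuration d R) : R :=
  2^-1 * (\sum_(e \in [set e : site d * site d | (e.1 \in L) || (e.2 \in L)])
            alpha * p e.1 e.2 * (x e.1 - x e.2) ^+ 2)
  + (1 - alpha) * \sum_(i <- L) (x i - data i) ^+ 2.

(* The configuration x_L y_{L^c}, for [x] in R^L *)
Definition splice (L : {fset (site d)}) (x : L -> R) (y : configuration d R) :
    configuration d R :=
  fun i => if insub i is Some k then x k else y i.

Definition restrict_to (L : {fset (site d)}) (x : configuration d R) : L -> R :=
  fun k => x (val k).

(* H(x') - H(x), for x' equal to x off L *)
Definition hamiltonian_diff (L : {fset (site d)}) (x' x : configuration d R) :
    R :=
  hamiltonian L (splice (restrict_to (L := L) x') x)
  - hamiltonian L (splice (restrict_to (L := L) x) x).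

Definition minimizes_hamiltonian (x : configuration d R) : Prop :=
  forall (x' : configuration d R) (L : {fset (site d)}),
    x' <> x -> (forall i, x' i <> x i -> i \in L) ->
    0 < hamiltonian_diff L x' x.

Definition local_minimizer (L : {fset (site d)}) (y : configuration d R) :
    L -> R :=
  get [set x : L -> R |
    forall z : L -> R, hamiltonian L (splice x y) <= hamiltonian L (splice z y)].

End hamiltonian.

(* Generators of the sigma-algebra of the coordinates in [J] *)
Definition coord_events (R : realType) (I : Type) (J : set I) :
    set (set (I -> R)) :=
  [set A | exists2 i, J i &
     exists2 B : set R, measurable B & A = [set x | B (x i)]].

(* R^I with its product sigma-algebra *)
Notation prod_space I R := (g_sigma_algebraType (@coord_events R I setT)).

(* R^{Z^d} with the sigma-algebra of the coordinates off [L] *)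
Notation outside_space L R :=
  (g_sigma_algebraType (@coord_events R _ [set i | i \notin L])).

Section ground_states.
Context (R : realType) (d : nat).
Variables (N : 'rV[R]_d -> R) (alpha rho : R) (p : site d -> site d -> R)
  (data : configuration d R).

Definition zero_temp_spec (L : {fset (site d)}) (y : configuration d R) :
    set (prod_space L R) -> \bar R :=
  @dirac _ (prod_space L R) (local_minimizer alpha p data y) R.

(* [kappa] is a regular conditional law of x_L given x_{L^c} under [mu]. *)
Definition is_conditional_law (mu : probability (prod_space (site d) R) R)
    (L : {fset (site d)})
    (kappa : R.-pker (outside_space L R) ~> (prod_space L R)) : Prop :=
  forall (A : set (prod_space L R)) (B : set (outside_space L R)),
    measurable A -> measurable B ->
    mu ((restrict_to (L := L) @^-1` A) `&` B) = (\int[mu]_(y in B) kappa y A)%E.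

Definition is_ground_state (mu : probability (prod_space (site d) R) R) :
    Prop :=
  mu (in_X N alpha rho) = 1%E /\
  forall L : {fset (site d)},
    exists2 kappa : R.-pker (outside_space L R) ~> (prod_space L R),
      is_conditional_law mu kappa &
      {ae mu, forall y, forall A : set (prod_space L R), measurable A ->
        kappa y A = zero_temp_spec y A}.

End ground_states.

(* Main.v *)
(* Write [A x i = alpha * sum_j p i j * x j] ([step]). Conditioning on the step
   at which the walk is killed gives [K = (1 - alpha) sum_n A^n], so [m] solves
   the Euler-Lagrange equation [x = (1 - alpha) d + A x] of [H]. As the jumps with
   positive probability are finitely many and strictly shorter than [rho], [A]
   contracts the weighted l^1 norm defining [X]: the series converges, [m] is in
   [X], and the equation has no other solution there. The Hamiltonian is strictly
   convex on each finite box, so its minimizer with boundary condition [m] is [m].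
   Conversely, a ground state satisfies the equation at [i] almost surely, by its
   conditional law on the box {i}; the sites being countably many, it is
   concentrated on the only solution. *)
Require Import Defs.
From HB Require Import structures.
From mathcomp Require Import all_boot all_order all_algebra finmap.
From mathcomp Require Import all_classical all_reals all_analysis measurable_realfun.
From mathcomp Require Import ring lra.

Set Implicit Arguments.
Unset Strict Implicit.
Unset Printing Implicit Defensive.

Import Order.TTheory GRing.Theory Num.Theory.
Import numFieldNormedType.Exports.

Local Open Scope classical_set_scope.
Local Open Scope ring_scope.

(** * Equivalence of norms *)

(** Killing is defined through the continuous-time path, while the given law only concerns finite
    stretches of the jump chain and lower bounds on holding times. Two facts bridge the gap: the
    total rate is 1 at every site, so the rates are themselves the transition probabilities of the
    chain; and off a null set a killing jump happens at a finite time and at most once. Convergence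
    is kept apart from algebra. Series are first formed in [0, +oo] for nonnegative data, where sums
    exchange freely; the weighted bound makes them finite afterwards. The equation at a site i can
    be tested on the box {i} because p(0,0) = 0: the average of x around i then involves only the
    other sites, so it is an event of the outside sigma-algebra. *)

Lemma dist_le_continuous (R : realType) (V : normedModType R) (f : V -> R)
    (C : R) : 0 < C -> (forall u v, `|f u - f v| <= C * `|u - v|) ->
  continuous f.
Proof.
move=> C0 fC v; apply/cvgrPdist_le => e e0; near=> u.
apply: le_trans (fC _ _) _; rewrite mulrC -ler_pdivlMr //.
by near: u; move/cvgrPdist_le: (@cvg_id _ (nbhs v)); apply; exact: divr_gt0.
Unshelve. all: by end_near. Qed.

Section norms.
Context (R : realType) (d : nat) (N : 'rV[R]_d -> R).
Hypothesis hN : is_norm N.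

Lemma is_norm0 : N 0 = 0.
Proof. by rewrite -(scale0r 0) (norm_homogeneous hN) normr0 mul0r. Qed.

Lemma is_normN v : N (- v) = N v.
Proof. by rewrite -scaleN1r (norm_homogeneous hN) normrN1 mul1r. Qed.

Lemma is_norm_ge0 v : 0 <= N v.
Proof.
have := norm_subadditive hN v (- v); rewrite subrr is_norm0 is_normN.
by move=> ?; lra.
Qed.

Lemma is_norm_dist u v : `|N u - N v| <= N (u - v).
Proof.
rewrite ler_norml; apply/andP; split.
  have := norm_subadditive hN u (v - u); rewrite addrCA subrr addr0.
  rewrite -[v - u]opprB is_normN => ?; lra.
have := norm_subadditive hN v (u - v); rewrite addrCA subrr addr0 => ?; lra.
Qed.

Lemma is_norm_le_mx_norm : exists2 C, 0 < C & forall v, N v <= C * `|v|.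
Proof.
pose C := \sum_(k < d) N (delta_mx 0 k).
have C0 : 0 <= C by apply: sumr_ge0 => k _; exact: is_norm_ge0.
(* The added 1 makes the constant positive even when the sum is zero. *)
exists (C + 1) => [|v]; first lra.
have sumN (F : 'I_d -> 'rV[R]_d) : N (\sum_k F k) <= \sum_k N (F k).
  elim/big_rec2: _ => [|k y x _ le]; first by rewrite is_norm0.
  by apply: le_trans (norm_subadditive hN _ _) _; rewrite lerD2l.
rewrite {1}[v]row_sum_delta; apply: le_trans (sumN _) _.
rewrite mulrDl mul1r mulr_suml -[leLHS]addr0 lerD //; apply: ler_sum => k _.
rewrite (norm_homogeneous hN) mulrC ler_wpM2l ?is_norm_ge0 //.
rewrite [leRHS]/Num.norm /= mx_normrE.
by apply: (le_bigmax _ (fun ij => `|v ij.1 ij.2|) (ord0, k)).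
Qed.

Lemma is_norm_continuous : continuous N.
Proof.
have [C C0 NC] := is_norm_le_mx_norm.
apply: (@dist_le_continuous R 'rV[R]_d N C) => // u v.
by apply: le_trans (is_norm_dist _ _) _; exact: NC.
Qed.

(* Norm equivalence: [N] attains a positive minimum on the compact unit sphere
   of the sup norm. *)
Lemma mx_norm_le_is_norm : exists2 c, 0 < c & forall v, c * `|v| <= N v.
Proof.
pose A : set 'rV[R]_d := [set v | `|v| = 1].
have [v0|] := pselect (A !=set0); last first.
  (* An empty unit sphere leaves only the zero vector, since any other could be normalised. *)
  move=> A0; exists 1 => // v; suff -> : v = 0 by rewrite normr0 mulr0 is_norm_ge0.
  apply/eqP/negPn/negP => v0; apply: A0; exists (`|v|^-1 *: v).
  by rewrite /A /= normrZ normfV normr_id mulVf // normr_eq0.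
have cA : compact A.
  apply: bounded_closed_compact.
    by exists 1; split => // M M1 v /= ->; exact: ltW.
  apply: (@closed_comp _ _ (fun v : 'rV[R]_d => `|v|) [set 1]).
    by move=> v _; exact: norm_continuous.
  exact: closed_eq.
have cN : {within A, continuous N}.
  by apply: continuous_subspaceT; exact: is_norm_continuous.
have [u] := EVT_min_rV v0 cA cN; rewrite inE => uA Nu.
have Nu0 : 0 < N u.
  rewrite lt_neqAle is_norm_ge0 andbT eq_sym; apply/eqP => /(norm_separated hN).
  by move=> u0; move: uA; rewrite /A /= u0 normr0 => /esym/eqP; rewrite oner_eq0.
exists (N u) => // v; have [->|v0'] := eqVneq v 0.
  by rewrite normr0 mulr0 is_norm_ge0.
have nv : 0 < `|v| by rewrite normr_gt0.
rewrite -ler_pdivlMr // mulrC.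
have -> : `|v|^-1 * N v = N (`|v|^-1 *: v).
  by rewrite (norm_homogeneous hN) ger0_norm // invr_ge0 normr_ge0.
by apply: Nu; rewrite inE /A /= normrZ normfV normr_id mulVf // normr_eq0.
Qed.

(** By norm equivalence all coordinates are integers in [-M, M]; the ball lies in the image of a
    finite cube of indices, shifted by M. *)
Lemma finite_site_ball r : finite_set [set j : site d | site_norm N j < r].
Proof.
have [c c0 cN] := mx_norm_le_is_norm.
have [M rM] : exists M : nat, r / c <= M%:R.
  exists (Num.truncn (r / c)).+1; exact/ltW/truncnS_gt.
pose f (g : {ffun 'I_d -> 'I_(M + M).+1}) : site d :=
  \row_k ((g k)%:Z - M%:Z).
apply: (@sub_finite_set _ _ (f @` setT)); last exact: finite_image.
move=> j /= jr; have jM k : (`|j 0 k| <= M%:Z)%R.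
  rewrite -(ler_int R) intr_norm; apply: (le_trans _ rM).
  rewrite ler_pdivlMr // mulrC; apply: le_trans (ltW jr).
  apply: le_trans (cN _); rewrite ler_pM2l //.
  rewrite {2}/Num.norm /= mx_normrE.
  have := le_bigmax (0 : R) (fun ij => `|map_mx intr j ij.1 ij.2| : R) (ord0, k).
  by rewrite /= mxE.
exists [ffun k => inord (absz (j 0 k + M%:Z))] => //.
apply/rowP => k; rewrite !mxE ffunE.
have /andP[jM1 jM2] : (- M%:Z <= j 0 k <= M%:Z)%R by rewrite -ler_norml.
rewrite inordK ?gez0_abs ?addrK //; first by rewrite -lerBlDr sub0r.
by rewrite ltnS -lez_nat gez0_abs ?PoszD ?lerD2r // -lerBlDr sub0r.
Qed.

End norms.

(** * The killed jump kernel on the weighted space *)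

Section nonnegative_sums.
Local Open Scope ereal_scope.
Context {R : realType}.

(** Only one inequality is direct. The other is the same inequality for the factor [c^-1], which is
    why c = 0 is treated apart. *)
Lemma esumZl (T : choiceType) (c : R) (a : T -> \bar R) : (0 <= c)%R ->
  (forall i, 0 <= a i) ->
  \esum_(i in [set: T]) (c%:E * a i) = c%:E * \esum_(i in [set: T]) a i.
Proof.
have le (k : R) (b : T -> \bar R) : (0 <= k)%R -> (forall i, 0 <= b i) ->
    \esum_(i in [set: T]) (k%:E * b i) <= k%:E * \esum_(i in [set: T]) b i.
  move=> k0 b0; apply: ge_ereal_sup => _ [X XD <-].
  rewrite -ge0_mule_fsumr //; apply: lee_wpmul2l; first by rewrite lee_fin.
  by apply: esum_ge; exists X.
move=> c0 a0; apply/eqP; rewrite eq_le le //=.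
have [->|cn0] := eqVneq c 0%R.
  by rewrite mul0e esum_ge0 // => i _; rewrite mul0e.
have {}c0 : (0 < c)%R by rewrite lt_neqAle eq_sym cn0.
have ca0 i : 0 <= c%:E * a i by rewrite mule_ge0 // lee_fin ltW.
rewrite -lee_pdivlMl //.
apply: le_trans (le c^-1%R _ _ ca0); last by rewrite invr_ge0 ltW.
by apply: le_esum => i _; rewrite muleA -EFinM mulVf ?mul1e.
Qed.

Lemma exchange_esum (T T' : choiceType) (a : T -> T' -> \bar R) :
  (forall i j, 0 <= a i j) ->
  \esum_(i in [set: T]) \esum_(j in [set: T']) a i j =
  \esum_(j in [set: T']) \esum_(i in [set: T]) a i j.
Proof.
move=> a0; rewrite !esum_esum // (reindex_esum ([set: T'] `*`` fun=> [set: T]) _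
  (fun x => (x.2, x.1))) //.
split => //; first by move=> [i j] [i' j'] _ _ /= [-> ->].
by move=> [i j] _; exists (j, i).
Qed.

Lemma esum_bij (T : choiceType) (h g : T -> T) (a : T -> \bar R) :
  cancel h g -> cancel g h ->
  \esum_(i in [set: T]) a (h i) = \esum_(i in [set: T]) a i.
Proof.
move=> hg gh; rewrite [RHS](reindex_esum setT setT h) //; split => //.
  by move=> i j _ _; exact: (can_inj hg).
by move=> i _; exists (g i).
Qed.

Lemma esum_finite_support (T : choiceType) (a : T -> R) (s : {fset T}) :
  (forall i, (0 <= a i)%R) -> (forall i, i \notin s -> a i = 0%R) ->
  \esum_(i in [set: T]) (a i)%:E = (\sum_(i <- s) a i)%:E.
Proof.
move=> a0 as0; rewrite (esumID [set` s]) ?setTI; last first.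
  by move=> i _; rewrite lee_fin.
rewrite [X in _ + X]esum1 ?adde0; last by move=> i /negP /as0 ->.
rewrite esum_fset //; last by move=> i _; rewrite lee_fin.
by rewrite -fsbig_seq ?fset_uniq // sumEFin.
Qed.

Lemma esum_nat_recl (a : nat -> \bar R) : (forall n, 0 <= a n) ->
  \esum_(n in [set: nat]) a n = a 0%N + \esum_(n in [set: nat]) a n.+1.
Proof.
move=> a0; rewrite -!nneseries_esumT // nneseries_recl // -nneseries_addn //.
by congr (_ + _); apply: eq_eseriesr => n _; rewrite addn1.
Qed.

Lemma esum_geometric_lty (c t : R) : (0 <= c)%R -> (0 <= t < 1)%R ->
  \esum_(n in [set: nat]) (c * t ^+ n)%:E < +oo.
Proof.
move=> c0 /andP[t0 t1]; have ct n : 0 <= (c * t ^+ n)%:E.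
  by rewrite lee_fin mulr_ge0 ?exprn_ge0.
rewrite -nneseries_esumT //; apply: (@le_lt_trans _ _ (c / (1 - t))%:E).
  apply: lime_le; first exact: is_cvg_nneseries.
  apply: nearW => n; rewrite sumEFin lee_fin.
  have := @geometric_seriesE R c t; rewrite lt_eqF // => /(_ isT)/(congr1 (@^~ n)).
  rewrite /series /= => ->; rewrite ler_pM2r ?invr_gt0 ?subr_gt0 //.
  by rewrite ler_piMr // gerBl exprn_ge0.
exact: ltry.
Qed.

End nonnegative_sums.

(** * The one-step operator and its contraction of the weighted norm *)

Section killed_kernel.
Context (R : realType) (d : nat) (N : 'rV[R]_d -> R).
Context (alpha rho : R) (p : site d -> site d -> R).
Hypotheses (hN : is_norm N) (halpha0 : 0 < alpha) (halpha1 : alpha < 1).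
Hypotheses (hrho : 0 < rho) (hp : is_jump_matrix N rho p).

Definition jump_support : {fset site d} := fset_set [set k | p 0 k != 0].

Lemma finite_jump_support : finite_set [set k | p 0 k != 0].
Proof.
apply: sub_finite_set (finite_site_ball hN rho) => k /=.
by rewrite ltNge; apply: contra => /(jump_finite_range hp) ->.
Qed.

Lemma mem_jump_support k : (k \in jump_support) = (p 0 k != 0).
Proof.
by rewrite in_fset_set ?mem_setE //; exact: finite_jump_support.
Qed.

Lemma jump_diff i j : p i j = p 0 (j - i).
Proof. by rewrite -(jump_homogeneous hp i) addrC subrK. Qed.

(** The set [T] is left free because two are needed: the translated support itself, and the
    neighbourhood of a whole box in the Hamiltonian. *)
Lemma sum_jump_reindex (T : {fset site d}) i (g : site d -> R) :
  (forall k, k \in jump_support -> i + k \in T) ->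
  \sum_(j <- T) p i j * g j = \sum_(k <- jump_support) p 0 k * g (i + k).
Proof.
move=> JT; pose h (k : site d) : site d := i + k.
pose S : {fset site d} := [fset h k | k in jump_support]%fset.
transitivity (\sum_(j <- S) p i j * g j); last first.
  rewrite big_imfset /=; last by move=> k l _ _ /addrI.
  by apply: eq_bigr => k _; rewrite (jump_homogeneous hp).
apply/esym/big_fset_incl.
  by apply/fsubsetP => _ /imfsetP[k /= kJ ->]; exact: JT.
move=> j _ jJ; rewrite jump_diff; have [->|pj] := eqVneq (p 0 (j - i)) 0.
  by rewrite mul0r.
case/negP: jJ; apply/imfsetP; exists (j - i); first by rewrite /= mem_jump_support.
by rewrite /h addrC subrK.
Qed.

Lemma esum_jump i (g : site d -> R) : (forall j, 0 <= g j) ->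
  (\esum_(j in [set: site d]) (p i j * g j)%:E =
    (\sum_(k <- jump_support) p 0 k * g (i + k))%:E)%E.
Proof.
move=> g0; pose T : {fset site d} := [fset (i + k)%R | k in jump_support]%fset.
rewrite (@esum_finite_support _ _ _ T); first last.
- move=> j jT; rewrite jump_diff; have [->|pj] := eqVneq (p 0 (j - i)) 0.
    by rewrite mul0r.
  case/negP: jT; apply/imfsetP; exists (j - i); first by rewrite /= mem_jump_support.
  by rewrite addrC subrK.
- by move=> j; rewrite mulr_ge0 // (jump_ge0 hp).
by rewrite (@sum_jump_reindex T) // => k kJ; apply/imfsetP; exists k.
Qed.

Lemma sum_jump : \sum_(k <- jump_support) p 0 k = 1.
Proof.
have := jump_stochastic hp 0.
under eq_esum do rewrite -[p 0 _]mulr1.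
rewrite (@esum_jump 0 (fun=> 1)) => [[]|//].
by under eq_bigr do rewrite mulr1.
Qed.

(** Summing over the finitely many jumps, rather than over all sites, makes this defined on every
    configuration, without summability. *)
Definition step (f : site d -> R) (i : site d) : R :=
  alpha * \sum_(k <- jump_support) p 0 k * f (i + k).

Lemma step_ge0 f : (forall i, 0 <= f i) -> forall i, 0 <= step f i.
Proof.
move=> f0 i; rewrite mulr_ge0 ?(ltW halpha0) // sumr_ge0 // => k _.
by rewrite mulr_ge0 // (jump_ge0 hp).
Qed.

Lemma iter_step_ge0 n f : (forall i, 0 <= f i) -> forall i, 0 <= iter n step f i.
Proof. by move=> f0; elim: n => //= n IH; exact: step_ge0. Qed.

Lemma stepB f g i : step (fun j => f j - g j) i = step f i - step g i.
Proof.
rewrite /step -mulrBr -sumrB; congr (_ * _); apply: eq_bigr => k _.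
by rewrite mulrBr.
Qed.

Lemma norm_step_le f i : `|step f i| <= step (fun j => `|f j|) i.
Proof.
rewrite /step normrM gtr0_norm // ler_pM2l //.
apply: le_trans (ler_norm_sum _ _ _) _; apply: ler_sum => k _.
by rewrite normrM ger0_norm // (jump_ge0 hp).
Qed.

Definition weight (i : site d) : R := alpha `^ (site_norm N i / rho).

Lemma weight_gt0 i : 0 < weight i.
Proof. exact: powR_gt0. Qed.

Lemma site_normD i j : site_norm N (i + j) <= site_norm N i + site_norm N j.
Proof. by rewrite /site_norm raddfD; exact: (norm_subadditive hN). Qed.

(** As alpha < 1, the weight decreases with the norm, so the triangle inequality makes it
    supermultiplicative. *)
Lemma weight_le_add i k : weight (i - k) <= weight i / weight k.
Proof.
rewrite ler_pdivlMr ?weight_gt0 // /weight -powRD; last by rewrite (gt_eqF halpha0) implybT.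
apply: ger_powR; first by rewrite halpha0 ltW.
rewrite -mulrDl ler_pM2r ?invr_gt0 //.
by have := site_normD (i - k) k; rewrite subrK.
Qed.

(** Bound for the norm of [step] on weighted l^1: shifting a configuration by a jump k costs at most
    a factor [1 / weight k]. *)
Definition contraction : R := alpha * \sum_(k <- jump_support) p 0 k / weight k.

Lemma contraction_ge0 : 0 <= contraction.
Proof.
rewrite mulr_ge0 ?(ltW halpha0) // sumr_ge0 // => k _.
by rewrite divr_ge0 ?(jump_ge0 hp) // ltW // weight_gt0.
Qed.

(* Strictness of the range condition [|k| < rho] makes [alpha / weight k < 1]
   for each of the finitely many jumps. *)
Lemma contraction_lt1 : contraction < 1.
Proof.
rewrite -sum_jump /contraction mulr_sumr big_seq [ltRHS]big_seq.
apply: ltr_sum.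
  apply/negPn/negP => /hasPn J0; have /eqP := sum_jump.
  by rewrite big_seq big_pred0 ?[0 == 1]eq_sym ?oner_eq0 // => k; apply/negP => kJ;
    have := J0 _ kJ; rewrite /= kJ.
move=> k; rewrite mem_jump_support => pk.
have pk0 : 0 < p 0 k by rewrite lt_neqAle eq_sym pk (jump_ge0 hp).
rewrite mulrCA gtr_pMr // ltr_pdivrMr ?weight_gt0 // mul1r.
have kr : site_norm N k < rho.
  by rewrite ltNge; apply: contra pk => /(jump_finite_range hp) ->.
rewrite /weight -[ltLHS]powRr1 ?ltW // /powR gt_eqF // ltr_expR.
rewrite ltr_nM2r ?ln_lt0 ?halpha0 //.
by rewrite ltr_pdivrMr // mul1r.
Qed.

(** The substitution of i - k for i moves the shift from f to the weight, where [weight_le_add]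
    bounds it. *)
Lemma esum_weight_step f : (forall i, 0 <= f i) ->
  (\esum_(i in [set: site d]) (weight i * step f i)%:E <=
   contraction%:E * \esum_(i in [set: site d]) (weight i * f i)%:E)%E.
Proof.
move=> f0; have w0 i := ltW (weight_gt0 i).
have c0 i k : 0 <= alpha * p 0 k * (weight i * f (i + k)).
  by rewrite !mulr_ge0 ?(jump_ge0 hp) // ltW.
have -> : (\esum_(i in [set: site d]) (weight i * step f i)%:E =
    \esum_(i in [set: site d])
      \sum_(k <- jump_support) (alpha * p 0 k * (weight i * f (i + k)))%:E)%E.
  apply: eq_esum => i _; rewrite sumEFin; congr EFin.
  by rewrite /step mulrCA !mulr_sumr; apply: eq_bigr => k _; ring.
rewrite esum_sum; last by move=> i k _ _; rewrite lee_fin.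
have -> : (\sum_(k <- jump_support)
    \esum_(i in [set: site d]) (alpha * p 0 k * (weight i * f (i + k)))%:E =
    \sum_(k <- jump_support)
    \esum_(i in [set: site d]) (alpha * p 0 k * (weight (i - k) * f i))%:E)%E.
  apply: eq_bigr => k _.
  have := esum_bij (fun i => (alpha * p 0 k * (weight (i - k) * f i))%:E)
    (addrK k) (subrK k).
  by move=> <-; apply: eq_esum => i _; rewrite addrK.
rewrite -esum_sum; last first.
  by move=> i k _ _; rewrite lee_fin !mulr_ge0 ?(jump_ge0 hp) // ltW.
rewrite -esumZl ?contraction_ge0 //; last by move=> i; rewrite lee_fin mulr_ge0.
apply: le_esum => i _; rewrite sumEFin -EFinM lee_fin.
rewrite /contraction mulr_sumr mulr_suml; apply: ler_sum => k _.
rewrite [leRHS](_ : _ = alpha * p 0 k * (weight i / weight k * f i)); last by ring.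
apply: ler_wpM2l; first by rewrite mulr_ge0 ?(jump_ge0 hp) // ltW.
by apply: ler_wpM2r => //; exact: weight_le_add.
Qed.

Lemma esum_weight_iter_step n f : (forall i, 0 <= f i) ->
  (\esum_(i in [set: site d]) (weight i * iter n step f i)%:E <=
   (contraction ^+ n)%:E * \esum_(i in [set: site d]) (weight i * f i)%:E)%E.
Proof.
move=> f0; elim: n => [|n IH]; first by rewrite expr0 mul1e.
apply: le_trans (esum_weight_step (iter_step_ge0 n f0)) _.
rewrite exprS [(_ * _ ^+ _)%:E]EFinM -muleA; apply: lee_wpmul2l => //.
by rewrite lee_fin contraction_ge0.
Qed.

End killed_kernel.

(** * The law of the killing site *)

Lemma at_left_ex (R : realType) (t : R) (P : set R) :
  (\forall s \near t^'-, P s) -> exists s, P s.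
Proof. exact: (@filter_ex _ _ (at_left_proper_filter t)). Qed.

Section killed_walk_path.
Local Open Scope ereal_scope.
Context {R : realType} {d : nat} {W : Type}.
Variables (Y : nat -> W -> option (site d)) (S : nat -> W -> \bar R).
Hypothesis S_gt0 : forall n w, 0 < S n w.

Definition jump_time (n : nat) (w : W) : \bar R := \sum_(k < n) S k w.

Lemma jump_timeS n w : jump_time n.+1 w = jump_time n w + S n w.
Proof. by rewrite /jump_time big_ord_recr. Qed.

Lemma jump_time_ge0 n w : 0 <= jump_time n w.
Proof. by apply: sume_ge0 => k _; exact: ltW. Qed.

Lemma jump_time_homo w : {homo jump_time ^~ w : m n / (m <= n)%N >-> m <= n}.
Proof.
apply: homo_leq => [//|y x z|n]; first exact: le_trans.
by rewrite jump_timeS leeDl // ltW.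
Qed.

(** The intervals between successive jump times are disjoint, so at most one state is occupied at a
    given real time. *)
Lemma jump_time_unique m n w (s : R) :
  jump_time m w <= s%:E -> s%:E < jump_time m.+1 w ->
  jump_time n w <= s%:E -> s%:E < jump_time n.+1 w -> m = n.
Proof.
have le k l : s%:E < jump_time k.+1 w -> jump_time l w <= s%:E -> (l <= k)%N.
  move=> sk ls; rewrite leqNgt; apply/negP => /(jump_time_homo w) kl.
  by have := lt_le_trans sk (le_trans kl ls); rewrite ltxx.
by move=> m1 m2 n1 n2; apply/eqP; rewrite eqn_leq !le.
Qed.

Lemma jump_time_fin n w (t : R) :
  jump_time n w <= t%:E -> jump_time n w \is a fin_num.
Proof.
by move=> nt; rewrite ge0_fin_numE ?jump_time_ge0 // (le_lt_trans nt) ?ltry.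
Qed.

Lemma holding_time_lty n w (t : R) : jump_time n.+1 w <= t%:E ->
  forall k, (k <= n)%N -> S k w < +oo.
Proof.
move=> nt k kn; apply: le_lt_trans (ltry t); apply: le_trans nt.
apply: le_trans (jump_time_homo w (kn : (k < n.+1)%N)).
by rewrite jump_timeS leeDr // jump_time_ge0.
Qed.

Definition kill_step (n : nat) (j : site d) : set W :=
  [set w | Y n w = Some j /\ Y n.+1 w = None].

(** Holds path by path. The witness time in [killed_at] is forced to be the jump time into the
    cemetery; the finite holding times say that this jump occurs at a real time. *)
Lemma killed_atE j : killed_at Y S j = \bigcup_n
  (kill_step n j `&` [set w | forall k, (k <= n)%N -> S k w < +oo]).
Proof.
apply/seteqP; split => w.
- case=> t [m [mt tm Ym]] nearY.
  (* If the m-th jump came strictly before t, some time in between would see both [None] and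
     [Some j]. *)
  have mE : jump_time m w = t%:E.
    apply/eqP; rewrite eq_le mt /= leNgt; apply/negP => mlt.
    have mf := jump_time_fin mt.
    have [s [[n [ns sn Yn]] ms st]] : exists s,
        [/\ walk_at Y S w s (Some j), jump_time m w <= s%:E & (s < t)%R].
      rewrite -(fineK mf) lte_fin in mlt.
      have [s [wY [/= gs st]]] := at_left_ex
        (filterI nearY (filterI (nbhs_left_gt mlt) (nbhs_left_lt t))).
      by exists s; split => //; rewrite -(fineK mf) lee_fin ltW.
    have sm : s%:E < jump_time m.+1 w by apply: lt_trans tm; rewrite lte_fin.
    by have mn := jump_time_unique ms sm ns sn; move: Ym; rewrite mn Yn.
  (* Jump time 0 is time 0, and the walk has no state at negative times, so m is a successor. *)
  case: m => [|n] in mt tm Ym mE *.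
    have [s [[n [ns _ _]] /= st]] :=
      at_left_ex (filterI nearY (nbhs_left_lt t)).
    have := le_trans (jump_time_ge0 n w) ns.
    move: mE; rewrite /jump_time big_ord0 => -[t0].
    by rewrite lee_fin leNgt t0 st.
  have nf : jump_time n w \is a fin_num.
    by apply: jump_time_fin (le_trans (jump_time_homo w (leqnSn n)) mt).
  have nt : (fine (jump_time n w) < t)%R.
    by rewrite -lte_fin fineK // -mE jump_timeS lteDl.
  exists n => //; split; last exact: holding_time_lty mt.
  split => //.
  have [s [[l [ls sl Yl]] [/= gs st]]] := at_left_ex
    (filterI nearY (filterI (nbhs_left_gt nt) (nbhs_left_lt t))).
  rewrite (@jump_time_unique n l w s) //; last by rewrite mE lte_fin.
  by rewrite -(fineK nf) lee_fin ltW.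
- case=> n _ [[Yn Yn1] Sn].
  have Sf k : (k <= n)%N -> S k w \is a fin_num.
    by move=> kn; rewrite ge0_fin_numE ?Sn // ltW.
  have tf : jump_time n w \is a fin_num.
    by apply/sum_fin_numP => k _ _; apply: Sf; exact: ltnW.
  pose t := (fine (jump_time n w) + fine (S n w))%R.
  have tE : jump_time n.+1 w = t%:E by rewrite jump_timeS EFinD !fineK ?Sf.
  exists t.
    exists n.+1; split => //; first by rewrite -tE.
    by rewrite -/(jump_time _ _) jump_timeS tE lteDl.
  have nt : (fine (jump_time n w) < t)%R.
    by rewrite ltrDl -lte_fin fineK ?Sf.
  near=> s; exists n; split => //.
  + rewrite -/(jump_time _ _) -(fineK tf) lee_fin; near: s.
    by apply: filterS (nbhs_left_gt nt) => s /ltW.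
  + rewrite -/(jump_time _ _) tE lte_fin; near: s; exact: nbhs_left_lt.
Unshelve. all: by end_near. Qed.

End killed_walk_path.

(** * Null sets and countable partitions *)

Section null_sets.
Local Open Scope ereal_scope.

Lemma measure_setD_null dT (T : measurableType dT) (R : realType)
    (mu : measure T R) (A B : set T) :
  measurable A -> measurable B -> mu B = 0 -> mu (A `\` B) = mu A.
Proof.
move=> mA mB B0; rewrite [RHS](measureDI mu mA mB) [X in _ = _ + X](_ : _ = 0).
  by rewrite adde0.
by apply: (subset_measure0 _ mB) => //; exact: measurableI.
Qed.

(** Countable additivity is indexed by natural numbers, so the values of X are coded by [pickle];
    numbers that code nothing contribute the empty set. *)
Lemma measure_partition dT (T : measurableType dT) (R : realType)
    (mu : measure T R) (I : countType) (X : T -> I) (E : set T) :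
  (forall i, measurable [set w | X w = i]) -> measurable E ->
  mu E = \esum_(i in [set: I]) mu (E `&` [set w | X w = i]).
Proof.
move=> mX mE.
pose F k : set T := if choice.pickle_inv k is Some i
  then E `&` [set w | X w = i] else set0.
have mF k : measurable (F k).
  by rewrite /F; case: choice.pickle_inv => // i; exact: measurableI.
have EF : E = \bigcup_k F k.
  apply/seteqP; split => w.
    by move=> Ew; exists (choice.pickle (X w)) => //; rewrite /F choice.pickleK_inv.
  by case=> k _; rewrite /F; case: choice.pickle_inv => // i [].
have tF : trivIset setT F.
  move=> k l _ _ [w []]; rewrite /F.
  case Ek : (choice.pickle_inv k) => [i|] //; case El : (choice.pickle_inv l) => [i'|] //.
  move=> [_ /= wi] [_ /= wi'].
  have := @choice.pickle_invK I k; have := @choice.pickle_invK I l.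
  by rewrite Ek El /= => <- <-; rewrite -wi -wi'.
rewrite {1}EF measure_bigcup //.
rewrite (_ : \sum_(i <oo | i \in setT) mu (F i) = \sum_(i <oo) mu (F i)); last first.
  by apply: eq_eseriesl => k; rewrite in_setT.
rewrite nneseries_esumT // (esumID (range (@choice.pickle I))) ?setTI //.
rewrite [X in _ + X]esum1 ?adde0; last first.
  move=> k Pk; rewrite /F; have := @choice.pickle_invK I k.
  case: choice.pickle_inv => [i /= ik|_]; last exact: measure0.
  by case: Pk; exists i.
rewrite esum_image; last by move=> i j _ _; exact: (pcan_inj choice.pickleK_inv).
by apply: eq_esum => i _; rewrite /F choice.pickleK_inv.
Qed.

Lemma esum_option (R : realType) (T : choiceType) (a : option T -> \bar R) :
  (forall b, 0 <= a b) ->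
  \esum_(b in [set: option T]) a b = a None + \esum_(j in [set: T]) a (Some j).
Proof.
move=> a0; rewrite (esumID [set None]) ?setTI // esum_set1 //; congr (_ + _).
rewrite (_ : ~` _ = range Some); last first.
  apply/seteqP; split => [[j|]|_ [j _ <-]] //=; first by exists j.
by rewrite esum_image // => i j _ _ [].
Qed.

End null_sets.

(** * From the law of finite paths to the law of the killing site *)

Section killed_walk_law.
Local Open Scope ereal_scope.
Context (R : realType) (d : nat) (N : 'rV[R]_d -> R).
Context (alpha rho : R) (p : site d -> site d -> R).
Hypotheses (hN : is_norm N) (halpha0 : (0 < alpha)%R) (halpha1 : (alpha < 1)%R).
Hypotheses (hrho : (0 < rho)%R) (hp : is_jump_matrix N rho p).
Context (dW : measure_display) (W : measurableType dW).
Context (Pr : site d -> probability W R) (Y : nat -> W -> option (site d)).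
Context (S : nat -> W -> \bar R).
Hypothesis hwalk : is_killed_walk alpha p Pr Y S.

#[local] Arguments jump_prob : simpl never.

Let mY n a : measurable [set w | Y n w = a] := walk_state_measurable hwalk n a.

Lemma walk_rate_ge0 a b : (0 <= walk_rate alpha p a b)%R.
Proof.
case: a b => [i|] [j|] //=; last by rewrite subr_ge0 ltW.
by rewrite mulr_ge0 ?(jump_ge0 hp) // ltW.
Qed.

(** The rate is alpha for a jump plus 1 - alpha for killing, by stochasticity of p. Dividing by it
    leaves the rates unchanged. *)
Lemma exit_rate_site i : exit_rate alpha p (Some i) = 1%R.
Proof.
rewrite /exit_rate esum_option; last by move=> b; rewrite lee_fin walk_rate_ge0.
rewrite (_ : esum _ _ = alpha%:E); first by rewrite /= subrK.
rewrite /=; under eq_esum do rewrite EFinM.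
by rewrite esumZl ?ltW // ?(jump_stochastic hp) ?mule1 // => j;
  rewrite lee_fin (jump_ge0 hp).
Qed.

Lemma jump_prob_site i j : jump_prob alpha p (Some i) (Some j) = (alpha * p i j)%R.
Proof. by rewrite /jump_prob exit_rate_site divr1. Qed.

Lemma jump_prob_kill i : jump_prob alpha p (Some i) None = (1 - alpha)%R.
Proof. by rewrite /jump_prob exit_rate_site divr1. Qed.

Lemma jump_prob_ge0 a b : (0 <= jump_prob alpha p a b)%R.
Proof.
case: a => [i|]; last by case: b.
by rewrite /jump_prob exit_rate_site divr1 walk_rate_ge0.
Qed.

Definition path_event (n : nat) (a : nat -> option (site d)) : set W :=
  [set w | forall k, (k <= n)%N -> Y k w = a k].

Definition path_prob (i : site d) (n : nat) (a : nat -> option (site d)) : R :=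
  ((a 0%N == Some i)%:R * \prod_(k < n) jump_prob alpha p (a k) (a k.+1))%R.

Lemma path_prob_ge0 i n a : (0 <= path_prob i n a)%R.
Proof. by rewrite mulr_ge0 ?ler0n // prodr_ge0 // => k _; exact: jump_prob_ge0. Qed.

Lemma path_probS i n a :
  path_prob i n.+1 a = (path_prob i n a * jump_prob alpha p (a n) (a n.+1))%R.
Proof. by rewrite /path_prob big_ord_recr /= mulrA. Qed.

Lemma measurable_path_event n a : measurable (path_event n a).
Proof.
rewrite (_ : path_event n a =
  \bigcap_(k in [set k | (k <= n)%N]) [set w | Y k w = a k]) //.
by apply: bigcap_measurableType => k _; exact: mY.
Qed.

(** [walk_law] with all time thresholds 0: holding times are positive everywhere, so the conditions
    on them are vacuous. *)
Lemma path_law i n a : Pr i (path_event n a) = (path_prob i n a)%:E.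
Proof.
have := walk_law hwalk i n a (t := fun=> 0%R) (fun=> lexx _).
under [in RHS]eq_bigr do rewrite mulr0 oppr0 expR0 mulr1.
move=> <-; congr (Pr i _); apply/seteqP; split => w /=; last by case.
by move=> Yw; split => // k _; exact: (walk_time_gt0 hwalk).
Qed.

Definition extend_path (n : nat) (a : nat -> option (site d)) b k :=
  if (k <= n)%N then a k else b.

Lemma path_event_extend n a b :
  path_event n.+1 (extend_path n a b) = path_event n a `&` [set w | Y n.+1 w = b].
Proof.
apply/seteqP; split => w /=.
  move=> Yw; split; last by have := Yw n.+1 (leqnn _); rewrite /extend_path ltnn.
  by move=> k kn; have := Yw k (leqW kn); rewrite /extend_path kn.
move=> [Yw Yn] k; rewrite /extend_path; case: ifPn => [kn _|]; first exact: Yw.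
by rewrite -ltnNge => nk kn; have -> : k = n.+1 by apply/eqP; rewrite eqn_leq nk kn.
Qed.

Lemma path_prob_extend i n a b :
  path_prob i n.+1 (extend_path n a b) =
  (path_prob i n a * jump_prob alpha p (a n) b)%R.
Proof.
rewrite path_probS /path_prob /extend_path leqnn ltnn.
rewrite leq0n; congr (_ * _ * _)%R; apply: eq_bigr => k _.
by rewrite (ltnW (ltn_ord k)) (ltn_ord k).
Qed.

(** Paths of a given length are countably many. Splitting on one further state at a time avoids
    enumerating them. *)
Lemma null_of_null_on_paths i n (E : set W) : measurable E ->
  (forall a, Pr i (E `&` path_event n a) = 0) -> Pr i E = 0.
Proof.
move=> mE; elim: n => [|n IH] E0.
  rewrite (@measure_partition _ _ _ (Pr i) _ (Y 0%N)) //.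
  rewrite esum1 // => b _; have := E0 (fun=> b); congr (Pr i _ = _).
  congr (_ `&` _); apply/seteqP; split => w /=; first exact.
  by move=> Yw k; rewrite leqn0 => /eqP ->.
apply: IH => a.
have mEa := measurableI _ _ mE (measurable_path_event n a).
rewrite (@measure_partition _ _ _ (Pr i) _ (Y n.+1)) // esum1 // => b _.
by rewrite -setIA -path_event_extend; exact: E0.
Qed.

Definition kernel_delta (j i : site d) : R := (i == j)%:R.

(** Conditional probability, in the state b, of jumping from j to the cemetery after l further
    steps; the factor 1 - alpha is that last jump. *)
Definition killed_from (l : nat) (j : site d) (b : option (site d)) : R :=
  if b is Some c then ((1 - alpha) * iter l (step alpha p) (kernel_delta j) c)%R
  else 0%R.

Lemma iter_step_delta_ge0 l j c : (0 <= iter l (step alpha p) (kernel_delta j) c)%R.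
Proof.
by apply: (iter_step_ge0 halpha0 hp) => i; rewrite /kernel_delta ler0n.
Qed.

Lemma killed_from_ge0 l j b : (0 <= killed_from l j b)%R.
Proof.
case: b => //= c; rewrite mulr_ge0 //; first by rewrite subr_ge0 ltW.
exact: iter_step_delta_ge0.
Qed.

Lemma measurable_kill_step n j : measurable (kill_step Y n j).
Proof. exact: measurableI (mY n (Some j)) (mY n.+1 None). Qed.

(** The Markov property in integrated form. Induction on l splits on the next state, which lengthens
    the prefix; hence the statement for an arbitrary prefix. *)
Lemma path_kill_law i j l k a :
  Pr i (path_event k a `&` kill_step Y (k + l) j) =
  (path_prob i k a * killed_from l j (a k))%:E.
Proof.
elim: l k a => [|l IH] k a.
  rewrite addn0 /=; have [akj|akj] := eqVneq (a k) (Some j).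
    rewrite (_ : _ `&` _ = path_event k.+1 (extend_path k a None)).
      rewrite path_law path_prob_extend akj jump_prob_kill /killed_from /=.
      by rewrite /kernel_delta eqxx mulr1.
    rewrite path_event_extend; apply/seteqP; split => w [aw /=]; first by case.
    by move=> Yk; split => //; split => //; rewrite -akj; exact: aw.
  rewrite (_ : _ `&` _ = set0); last first.
    apply/seteqP; split => // w [aw [Yk _]].
    by move: akj; rewrite -Yk aw // eqxx.
  rewrite measure0; case: (a k) akj => [c|] /= cj; last by rewrite mulr0.
  by rewrite /kernel_delta (negPf (_ : c != j)) ?mulr0.
have mE := measurableI _ _ (measurable_path_event k a) (measurable_kill_step (k + l.+1) j).
rewrite (@measure_partition _ _ _ (Pr i) _ (Y k.+1)) //.
have stepE b : Pr i (path_event k a `&` kill_step Y (k + l.+1) j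
      `&` [set w | Y k.+1 w = b]) =
    (path_prob i k a * jump_prob alpha p (a k) b * killed_from l j b)%:E.
  rewrite setIAC -path_event_extend addnS -[(k + l).+1]addSn IH path_prob_extend.
  by rewrite /extend_path ltnn.
rewrite (eq_esum (fun b _ => stepE b)).
rewrite esum_option /=; last first.
  move=> b; rewrite lee_fin; apply: mulr_ge0; last exact: killed_from_ge0.
  by apply: mulr_ge0; [exact: path_prob_ge0 | exact: jump_prob_ge0].
rewrite mulr0 add0e; case: (a k) => [c|]; last first.
  by rewrite esum1 /= ?mulr0 // => z _; rewrite /jump_prob mulr0 mul0r.
pose g z := (alpha * (1 - alpha) * iter l (step alpha p) (kernel_delta j) z)%R.
have g0 z : (0 <= g z)%R.
  by rewrite !mulr_ge0 ?(ltW halpha0) ?subr_ge0 ?(ltW halpha1) // iter_step_delta_ge0.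
transitivity (\esum_(z in [set: site d]) ((path_prob i k a)%:E * (p c z * g z)%:E)).
  apply: eq_esum => z _; rewrite jump_prob_site -EFinM /g; congr EFin; ring.
rewrite esumZl ?path_prob_ge0 //; last by move=> z; rewrite lee_fin mulr_ge0 ?(jump_ge0 hp).
rewrite (esum_jump hN hp) // -EFinM; congr (EFin _); congr (_ * _)%R.
rewrite /killed_from iterS {2}/step mulrA mulr_sumr; apply: eq_bigr => z _.
by rewrite /g; ring.
Qed.

(** The case of a prefix reduced to the starting site, an event of probability 1 under [Pr i]. *)
Lemma kill_step_law i j n :
  Pr i (kill_step Y n j) =
  ((1 - alpha) * iter n (step alpha p) (kernel_delta j) i)%:E.
Proof.
have mE := measurable_kill_step n j.
pose a (k : nat) := Some i.
have := path_kill_law i j n 0 a; rewrite add0n /path_prob eqxx big_ord0 !mul1r /= => <-.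
have mC := measurableC (measurable_path_event 0 a).
have C0 : Pr i (~` path_event 0 a) = 0.
  have P1 : Pr i (path_event 0 a) = 1.
    by rewrite path_law /path_prob eqxx big_ord0 mulr1.
  rewrite probability_setC; last exact: measurable_path_event.
  by rewrite [X in 1 - X](_ : _ = 1) ?subee //; exact: P1.
rewrite -(measure_setD_null mE mC C0) setDE setCK setIC //.
Qed.

Lemma cemetery_absorbing i n :
  Pr i [set w | Y n w = None /\ Y n.+1 w <> None] = 0.
Proof.
have mE : measurable [set w | Y n w = None /\ Y n.+1 w <> None].
  by apply: measurableI; [exact: mY | apply: measurableC; exact: mY].
apply: (@null_of_null_on_paths _ n.+1) => // a.
have [an|an] := eqVneq (a n) None; last first.
  rewrite (_ : _ `&` _ = set0) ?measure0 //; apply/seteqP; split => // w [[Yn _] aw].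
  by move: an; rewrite -aw // Yn.
case an1 : (a n.+1) => [c|]; last first.
  rewrite (_ : _ `&` _ = set0) ?measure0 //; apply/seteqP; split => // w [[_ Yn] aw].
  by apply: Yn; rewrite aw.
have a0 : Pr i (path_event n.+1 a) = 0.
  by rewrite path_law path_probS an an1 /jump_prob /= mulr0.
apply: (subset_measure0 _ (measurable_path_event n.+1 a)); last exact: a0.
- by apply: measurableI => //; exact: measurable_path_event.
- by move=> w [].
Qed.

Lemma measurable_holding_lty n : measurable [set w | S n w < +oo].
Proof.
have := emeasurable_fun_infty_o measurableT (walk_time_measurable hwalk n) +oo.
by rewrite setTI.
Qed.

(** On a path whose n-th state is a site, an infinite holding time exceeds every m, so the
    exponential tail bounds the probability by a constant times exp(-m). *)
Lemma holding_time_finite i n :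
  Pr i [set w | Y n w <> None /\ ~ (S n w < +oo)] = 0.
Proof.
have mE : measurable [set w | Y n w <> None /\ ~ (S n w < +oo)].
  apply: measurableI; apply: measurableC; first exact: mY.
  exact: measurable_holding_lty.
apply: (@null_of_null_on_paths _ n.+1) => // a.
have mEa := measurableI _ _ mE (measurable_path_event n.+1 a).
case an : (a n) => [c|]; last first.
  rewrite (_ : _ `&` _ = set0) ?measure0 //; apply/seteqP; split => // w [[Yn _] aw].
  by apply: Yn; rewrite aw.
have bound (m : nat) : Pr i ([set w | Y n w <> None /\ ~ (S n w < +oo)] `&` path_event n.+1 a)
    <= (path_prob i n.+1 a * expR (- m%:R))%:E.
  (* A threshold at step n only, so that every other exponential factor is 1. *)
  pose t k : R := if k == n then m%:R else 0%R.
  have t0 k : (0 <= t k)%R by rewrite /t; case: ifP.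
  have mt : measurable [set w | (forall k, (k <= n.+1)%N -> Y k w = a k) /\
                  (forall k, (k < n.+1)%N -> ((t k)%:E < S k w)%E)].
    apply: measurableI; first exact: measurable_path_event.
    apply: (@eq_ind_r _ (\bigcap_(k in [set k | (k < n.+1)%N])
      [set w | (t k)%:E < S k w]) measurable _ _ erefl).
    apply: bigcap_measurableType => k _.
    have := emeasurable_fun_o_infty measurableT (walk_time_measurable hwalk k) (t k)%:E.
    by rewrite setTI.
  have := walk_law hwalk i n.+1 a t0; rewrite big_ord_recr /=.
  rewrite (eq_bigr (fun k : 'I_n => jump_prob alpha p (a k) (a k.+1))); last first.
    by move=> k _; rewrite /t ltn_eqF // mulr0 oppr0 expR0 mulr1.
  have -> : exit_rate alpha p (a n) = 1%R by rewrite an exit_rate_site.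
  rewrite /t eqxx mul1r !mulrA -/(path_prob i n a).
  rewrite -path_probS => <-; apply: le_measure; rewrite ?inE //.
  move=> w [[_ Sw] aw]; split => // k kn.
  case: ifP => [/eqP ->|_]; last exact: (walk_time_gt0 hwalk).
  by move/negP: Sw; rewrite -leNgt leye_eq => /eqP ->; rewrite ltry.
set x := Pr i _ in bound *.
have xf : x \is a fin_num by exact: fin_num_measure.
apply/eqP; rewrite eq_le measure_ge0 andbT -(fineK xf) lee_fin.
apply/ler_addgt0Pr => e e0; rewrite add0r.
set c0 := path_prob i n.+1 a in bound.
have c00 : (0 <= c0)%R := path_prob_ge0 _ _ _.
(* With m the first integer above c0 / e, the bound exp(m) >= 1 + m >= c0 / e gives c0 exp(-m) <=
   e. *)
apply: (@le_trans _ _ (c0 * expR (- (Num.truncn (c0 / e)).+1%:R))%R).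
  by rewrite -lee_fin fineK.
rewrite expRN ler_pdivrMr ?expR_gt0 // mulrC -ler_pdivrMr //.
apply: le_trans (expR_ge1Dx _); apply: le_trans (ltW (truncnS_gt _)) _.
by rewrite lerDr.
Qed.

Lemma measurable_kill_step_finite n j : measurable
  (kill_step Y n j `&` [set w | forall k, (k <= n)%N -> S k w < +oo]).
Proof.
apply: measurableI; first exact: measurable_kill_step.
apply: (@eq_ind_r _ (\bigcap_(k in [set k | (k <= n)%N])
  [set w | S k w < +oo]) measurable _ _ erefl).
by apply: bigcap_measurableType => k _; exact: measurable_holding_lty.
Qed.

Lemma measurable_killed_at j : measurable (killed_at Y S j).
Proof.
rewrite killed_atE; last exact: (walk_time_gt0 hwalk).
by apply: bigcupT_measurable => n; exact: measurable_kill_step_finite.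
Qed.

(* Off a null set the walk stays in the cemetery once there and all earlier
   holding times are finite, so that being killed at [j] amounts to jumping from
   [j] to the cemetery at exactly one step. *)
Lemma kill_law i j :
  Pr i (killed_at Y S j) = \esum_(n in [set: nat])
    ((1 - alpha) * iter n (step alpha p) (kernel_delta j) i)%:E.
Proof.
pose B1 n : set W := [set w | Y n w = None /\ Y n.+1 w <> None].
pose B2 n : set W := [set w | Y n w <> None /\ ~ (S n w < +oo)].
pose B := (\bigcup_n B1 n) `|` (\bigcup_n B2 n).
have mB1 n : measurable (B1 n).
  by apply: measurableI; [exact: mY | apply: measurableC; exact: mY].
have mB2 n : measurable (B2 n).
  apply: measurableI; apply: measurableC; first exact: mY.
  exact: measurable_holding_lty.
have mB : measurable B by apply: measurableU; exact: bigcupT_measurable.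
have B0 : Pr i B = 0.
  apply: measure_negligible => //; apply: negligibleU; apply: negligible_bigcup => n;
    apply/negligibleP => //; [exact: cemetery_absorbing | exact: holding_time_finite].
have absorbed n k w : ~ B w -> Y n w = None -> Y (n + k)%N w = None.
  move=> Bw Yn; elim: k => [|k IH]; rewrite ?addn0 // addnS.
  by apply: contra_notP Bw => Yk; left; exists (n + k)%N.
rewrite killed_atE; last exact: (walk_time_gt0 hwalk).
set F := fun n => kill_step Y n j `&` [set w | forall k, (k <= n)%N -> S k w < +oo].
have mF n : measurable (F n) := measurable_kill_step_finite n j.
have mUF : measurable (\bigcup_n F n) by exact: bigcupT_measurable.
have FB n : F n `\` B = kill_step Y n j `\` B.
  apply/seteqP; split => w; first by case=> -[].
  case=> -[Yn Yn1] Bw; split => //; split => // k kn.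
  have [//|Sk] := pselect (S k w < +oo).
  exfalso; apply: (Bw); right; exists k => //; split => // Yk.
  by have := absorbed k (n - k)%N w Bw Yk; rewrite subnKC // Yn.
have tF : trivIset setT (fun n => F n `\` B).
  have lt_absurd m n w : (m < n)%N -> (F m `\` B) w -> ~ (F n `\` B) w.
    move=> mn [[[_ Ym1] _] Bw] [[[Yn _] _] _].
    by have := absorbed m.+1 (n - m.+1)%N w Bw Ym1; rewrite subnKC // Yn.
  move=> m n _ _ [w [Fm Fn]]; case: (ltngtP m n) => // mn.
    by case: (lt_absurd m n w mn Fm).
  by case: (lt_absurd n m w mn Fn).
rewrite -(measure_setD_null mUF mB B0) setDE setI_bigcupl.
rewrite (measure_bigcup _ [set: nat]) //; last first.
  by move=> n _; rewrite -setDE; exact: measurableD.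
rewrite (_ : \sum_(n <oo | n \in setT) Pr i (F n `&` ~` B) =
    \sum_(n <oo) Pr i (F n `&` ~` B)); last first.
  by apply: eq_eseriesl => n; rewrite in_setT.
rewrite nneseries_esumT //; apply: eq_esum => n _.
rewrite -setDE FB -kill_step_law.
exact: measure_setD_null (measurable_kill_step n j) mB B0.
Qed.

End killed_walk_law.

(** * The Green function and the fixed-point equation *)

Section green_function.
Local Open Scope ereal_scope.
Context (R : realType) (d : nat) (N : 'rV[R]_d -> R).
Context (alpha rho : R) (p : site d -> site d -> R).
Hypotheses (hN : is_norm N) (halpha0 : (0 < alpha)%R) (halpha1 : (alpha < 1)%R).
Hypotheses (hrho : (0 < rho)%R) (hp : is_jump_matrix N rho p).
Implicit Types (f g x y : site d -> R).

Let onem_alpha_ge0 : (0 <= 1 - alpha)%R. Proof. by rewrite subr_ge0 ltW. Qed.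

Local Notation step := (step alpha p).
Local Notation weight := (weight N alpha rho).

(** Extended-real values let the series exist for every nonnegative g before convergence is known.
    On the indicator of j it is K(i, j). *)
Definition green g i : \bar R :=
  \esum_(n in [set: nat]) ((1 - alpha) * iter n step g i)%:E.

Lemma green_term_ge0 g i n : (forall j, (0 <= g j)%R) ->
  0 <= ((1 - alpha) * iter n step g i)%:E.
Proof.
by move=> g0; rewrite lee_fin mulr_ge0 // (iter_step_ge0 halpha0 hp).
Qed.

Lemma green_ge0 g i : (forall j, (0 <= g j)%R) -> 0 <= green g i.
Proof. by move=> g0; apply: esum_ge0 => n _; exact: green_term_ge0. Qed.

(** The iterates of the indicator of j are the j-th column of A^n, so this is the matrix product A^n
    g. *)
Lemma esum_iter_step_delta g n i : (forall j, (0 <= g j)%R) ->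
  \esum_(j in [set: site d]) (g j * iter n step (kernel_delta R j) i)%:E =
  (iter n step g i)%:E.
Proof.
move=> g0; elim: n i => [|n IH] i /=.
  rewrite (@esum_finite_support _ _ _ [fset i]%fset).
  - by rewrite big_seq_fset1 /kernel_delta eqxx mulr1.
  - by move=> j; rewrite mulr_ge0 // /kernel_delta ler0n.
  - by move=> j; rewrite inE /kernel_delta eq_sym => /negPf ->; rewrite mulr0.
have d0 j k : (0 <= g j * iter n step (kernel_delta R j) (i + k))%R.
  by rewrite mulr_ge0 // (iter_step_delta_ge0 halpha0 hp).
transitivity (\esum_(j in [set: site d]) \sum_(k <- jump_support p)
    ((alpha * p 0%R k)%:E * (g j * iter n step (kernel_delta R j) (i + k))%:E)).
  apply: eq_esum => j _; rewrite sumEFin; congr EFin.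
  by rewrite /step mulrCA !mulr_sumr; apply: eq_bigr => k _; ring.
rewrite esum_sum; last first.
  move=> j k _ _; rewrite mule_ge0 ?lee_fin //.
  by rewrite mulr_ge0 ?(jump_ge0 hp) // ltW.
rewrite /step mulr_sumr -sumEFin; apply: eq_bigr => k _.
rewrite esumZl ?mulr_ge0 ?(jump_ge0 hp) ?(ltW halpha0) //; last first.
  by move=> j; rewrite lee_fin.
by rewrite IH -EFinM mulrA.
Qed.

(** Superposition over the indicators, by exchanging the sums over sites and over steps; it turns
    averages against K into [green]. *)
Lemma esum_green_delta g i : (forall j, (0 <= g j)%R) ->
  \esum_(j in [set: site d]) ((g j)%:E * green (kernel_delta R j) i) = green g i.
Proof.
move=> g0; have d0 j k : (0 <= kernel_delta R j k)%R by rewrite ler0n.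
transitivity (\esum_(j in [set: site d]) \esum_(n in [set: nat])
    ((g j)%:E * ((1 - alpha) * iter n step (kernel_delta R j) i)%:E)).
  by apply: eq_esum => j _; rewrite esumZl // => n; exact: green_term_ge0.
rewrite exchange_esum; last first.
  by move=> j n; rewrite mule_ge0 ?lee_fin //; exact: green_term_ge0.
apply: eq_esum => n _; rewrite EFinM -esum_iter_step_delta // -esumZl //.
  by apply: eq_esum => j _; rewrite -!EFinM; congr EFin; ring.
by move=> j; rewrite lee_fin mulr_ge0 // (iter_step_delta_ge0 halpha0 hp).
Qed.

(** After exchanging sums, the n-th term is at most a constant times [contraction ^+ n]: a
    convergent geometric series. *)
Lemma esum_weight_green_lty g : (forall j, (0 <= g j)%R) ->
  \esum_(i in [set: site d]) (weight i * g i)%:E < +oo ->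
  \esum_(i in [set: site d]) ((weight i)%:E * green g i) < +oo.
Proof.
move=> g0 gfin; have w0 i : (0 <= weight i)%R by rewrite ltW // weight_gt0.
set r := \esum_(i in _) _ in gfin.
have rfin : r \is a fin_num.
  rewrite ge0_fin_numE // esum_ge0 // => i _.
  by rewrite lee_fin mulr_ge0.
have it0 n i : 0 <= (weight i * iter n step g i)%:E.
  by rewrite lee_fin mulr_ge0 // (iter_step_ge0 halpha0 hp).
have -> : \esum_(i in [set: site d]) ((weight i)%:E * green g i) =
    \esum_(i in [set: site d]) \esum_(n in [set: nat])
      ((1 - alpha)%:E * (weight i * iter n step g i)%:E).
  apply: eq_esum => i _; rewrite -esumZl //; last by move=> n; exact: green_term_ge0.
  by apply: eq_esum => n _; rewrite -!EFinM mulrCA.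
rewrite exchange_esum; last by move=> i n; rewrite mule_ge0 ?lee_fin // -lee_fin.
set c := contraction N alpha rho p.
have c0 : (0 <= c)%R := contraction_ge0 halpha0 hp.
have c1 : (c < 1)%R := contraction_lt1 hN halpha0 halpha1 hrho hp.
apply: (@le_lt_trans _ _ (\esum_(n in [set: nat]) ((1 - alpha) * fine r * c ^+ n)%:E)).
  apply: le_esum => n _; rewrite esumZl // -mulrA EFinM.
  apply: lee_wpmul2l; first by rewrite lee_fin.
  rewrite mulrC EFinM fineK //.
  exact: (esum_weight_iter_step hN halpha0 halpha1 hrho hp).
apply: esum_geometric_lty; last by rewrite c0.
by rewrite mulr_ge0 // fine_ge0 // esum_ge0 // => i _; rewrite lee_fin mulr_ge0.
Qed.

(** A single term of the finite weighted sum is finite, and its weight is positive. *)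
Lemma green_fin_num g i : (forall j, (0 <= g j)%R) ->
  \esum_(i in [set: site d]) (weight i * g i)%:E < +oo -> green g i \is a fin_num.
Proof.
move=> g0 /(esum_weight_green_lty g0) wG; rewrite ge0_fin_numE ?green_ge0 //.
have w0 j : (0 < weight j)%R by exact: weight_gt0.
have : (weight i)%:E * green g i < +oo.
  apply: le_lt_trans wG; apply: esum_ge; exists [set i].
    by split => //; exact: finite_set1.
  by rewrite fsbig_set1.
case: (green g i) (green_ge0 i g0) => [r _ _|_|//]; first exact: ltry.
by rewrite gt0_muley ?lte_fin.
Qed.

(** The term n = 0 is (1 - alpha) g; the remaining ones are [step] applied to the series. *)
Lemma greenE g i : (forall j, (0 <= g j)%R) ->
  \esum_(i in [set: site d]) (weight i * g i)%:E < +oo ->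
  fine (green g i) = ((1 - alpha) * g i + step (fun j => fine (green g j)) i)%R.
Proof.
move=> g0 gfin; have Gf j : green g j \is a fin_num by exact: green_fin_num.
apply: EFin_inj; rewrite fineK // {1}/green esum_nat_recl /=; last first.
  by move=> n; exact: green_term_ge0.
rewrite EFinD; congr (_ + _).
transitivity (\esum_(n in [set: nat]) \sum_(k <- jump_support p)
    ((alpha * p 0%R k)%:E * ((1 - alpha) * iter n step g (i + k))%:E)).
  apply: eq_esum => n _; rewrite sumEFin; congr EFin.
  by rewrite /step mulrCA !mulr_sumr; apply: eq_bigr => k _; ring.
rewrite esum_sum; last first.
  move=> n k _ _; rewrite mule_ge0 //; last exact: green_term_ge0.
  by rewrite lee_fin mulr_ge0 ?(jump_ge0 hp) // ltW.
rewrite /step mulr_sumr -sumEFin; apply: eq_bigr => k _.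
rewrite esumZl ?mulr_ge0 ?(jump_ge0 hp) ?(ltW halpha0) //; last first.
  by move=> n; exact: green_term_ge0.
by rewrite mulrA [RHS]EFinM fineK.
Qed.

Definition solves (data x : site d -> R) : Prop :=
  forall i, x i = ((1 - alpha) * data i + step x i)%R.

(** The absolute difference u satisfies u <= A u, so its weighted sum r satisfies r <= c r with c <
    1. Membership in X makes r finite, which forces r = 0. *)
Lemma solves_unique data x y :
  in_X N alpha rho x -> in_X N alpha rho y ->
  solves data x -> solves data y -> x = y.
Proof.
move=> xX yX xS yS; pose u i := (`|x i - y i|)%R.
have w0 i : (0 < weight i)%R by exact: weight_gt0.
have u0 i : (0 <= u i)%R by exact: normr_ge0.
have ule i : (u i <= step u i)%R.
  have -> : u i = `|step (fun j => x j - y j) i|%R.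
    by rewrite /u stepB {1}(xS i) {1}(yS i); congr (`|_|)%R; ring.
  exact: (norm_step_le halpha0 hp).
set r := \esum_(i in [set: site d]) (weight i * u i)%:E.
have r0 : 0 <= r by apply: esum_ge0 => i _; rewrite lee_fin mulr_ge0 // ltW.
have rfin : r \is a fin_num.
  rewrite ge0_fin_numE //.
  apply: (@le_lt_trans _ _ (\esum_(i in [set: site d]) (`|x i| * weight i)%:E +
      \esum_(i in [set: site d]) (`|y i| * weight i)%:E)); last exact: lte_add_pinfty.
  rewrite -esumD; [|by move=> i _; rewrite lee_fin mulr_ge0 // ltW..].
  apply: le_esum => i _; rewrite -EFinD lee_fin -mulrDl mulrC ler_pM2r //.
  exact: ler_normB.
have rr : r <= (contraction N alpha rho p)%:E * r.
  apply: le_trans (esum_weight_step hN halpha0 halpha1 hrho hp u0).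
  by apply: le_esum => i _; rewrite lee_fin ler_pM2l.
have r_eq0 : r = 0.
  apply/eqP; rewrite eq_le r0 andbT; move: rr; rewrite -(fineK rfin) -EFinM !lee_fin.
  have := contraction_lt1 hN halpha0 halpha1 hrho hp.
  set c := contraction _ _ _ _ => c1 rc; rewrite leNgt; apply/negP => rp.
  by move: rc; rewrite leNgt gtr_pMl // c1.
apply/funext => i; apply/eqP; rewrite -subr_eq0 -normr_eq0 eq_le normr_ge0 andbT.
rewrite -(pmulr_rle0 _ (w0 i)).
suff : (weight i * u i)%:E <= r by rewrite r_eq0 lee_fin.
apply: esum_ge; exists [set i]; first by split => //; exact: finite_set1.
by rewrite fsbig_set1.
Qed.

End green_function.

(** * The average of the data against the killing kernel *)

Section kernel_average.
Local Open Scope ereal_scope.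
Context (R : realType) (d : nat) (N : 'rV[R]_d -> R).
Context (alpha rho : R) (p : site d -> site d -> R) (data : site d -> R).
Hypotheses (hN : is_norm N) (halpha0 : (0 < alpha)%R) (halpha1 : (alpha < 1)%R).
Hypotheses (hrho : (0 < rho)%R) (hp : is_jump_matrix N rho p).
Context (dW : measure_display) (W : measurableType dW).
Context (Pr : site d -> probability W R) (Y : nat -> W -> option (site d)).
Context (S : nat -> W -> \bar R).
Hypothesis hwalk : is_killed_walk alpha p Pr Y S.
Hypothesis hdata : in_X N alpha rho data.

Local Notation green := (green alpha p).
Local Notation weight := (weight N alpha rho).
Local Notation K := (kill_prob Pr Y S).

Lemma kill_prob_ge0 i j : (0 <= K i j)%R.
Proof. exact: fine_ge0. Qed.

Lemma kill_probE i j : (K i j)%:E = green (kernel_delta R j) i.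
Proof.
transitivity (Pr i (killed_at Y S j)).
  rewrite /kill_prob fineK //.
  by apply: fin_num_measure; exact: measurable_killed_at hwalk _.
exact: (kill_law hN halpha0 halpha1 hp hwalk).
Qed.

(* Splitting the data into positive and negative parts keeps every sum in
   [0, +oo], where sums may be exchanged freely. *)
Definition data_pos j : R := Num.max (data j) 0%R.
Definition data_neg j : R := Num.max (- data j)%R 0%R.

Lemma data_pos_ge0 j : (0 <= data_pos j)%R.
Proof. by rewrite le_max lexx orbT. Qed.

Lemma data_neg_ge0 j : (0 <= data_neg j)%R.
Proof. by rewrite le_max lexx orbT. Qed.

Lemma data_posBneg j : (data_pos j - data_neg j)%R = data j.
Proof.
rewrite /data_pos /data_neg; case: (leP (data j) 0%R) => h.
  by rewrite max_l ?oppr_ge0 // sub0r opprK.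
by rewrite max_r ?subr0 // oppr_le0 ltW.
Qed.

Lemma esum_weight_le_data g : (forall j, (g j <= `|data j|)%R) ->
  \esum_(i in [set: site d]) (weight i * g i)%:E < +oo.
Proof.
move=> gd; apply: le_lt_trans hdata; apply: le_esum => i _.
by rewrite lee_fin mulrC ler_pM2r // weight_gt0.
Qed.

Lemma esum_weight_data_pos :
  \esum_(i in [set: site d]) (weight i * data_pos i)%:E < +oo.
Proof.
by apply: esum_weight_le_data => j; rewrite ge_max ler_norm normr_ge0.
Qed.

Lemma esum_weight_data_neg :
  \esum_(i in [set: site d]) (weight i * data_neg i)%:E < +oo.
Proof.
by apply: esum_weight_le_data => j; rewrite ge_max normr_ge0 andbT -normrN ler_norm.
Qed.

Lemma esum_kill_prob g i : (forall j, (0 <= g j)%R) ->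
  \esum_(j in [set: site d]) (K i j * g j)%:E = green g i.
Proof.
move=> g0; rewrite -(esum_green_delta halpha0 halpha1 hp) //.
by apply: eq_esum => j _; rewrite EFinM kill_probE muleC.
Qed.

Lemma kill_prob_summable i :
  summable [set: site d] (fun j => (K i j * data j)%:E).
Proof.
rewrite /summable.
have g0 j : (0 <= `|data j|)%R by exact: normr_ge0.
have gf := esum_weight_le_data (fun j => lexx `|data j|%R).
have := green_fin_num hN halpha0 halpha1 hrho hp i g0 gf.
rewrite ge0_fin_numE; last exact: (green_ge0 halpha0 halpha1 hp).
rewrite -esum_kill_prob // => fin; apply: le_lt_trans fin; apply: le_esum => j _.
by rewrite abse_EFin normrM ger0_norm ?kill_prob_ge0.
Qed.

Definition kernel_average i : R := family_sum (fun j => (K i j * data j)%R).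

Lemma kernel_averageE i :
  kernel_average i = (fine (green data_pos i) - fine (green data_neg i))%R.
Proof.
rewrite /kernel_average /family_sum.
have -> : \esum_(j in [set: site d]) ((EFin \o (fun j => (K i j * data j)%R))^\+ j) =
    green data_pos i.
  rewrite -esum_kill_prob; last exact: data_pos_ge0.
  apply: eq_esum => j _; rewrite funeposE /= -EFin_max; congr EFin.
  by rewrite /data_pos maxr_pMr ?kill_prob_ge0 // mulr0.
have -> : \esum_(j in [set: site d]) ((EFin \o (fun j => (K i j * data j)%R))^\- j) =
    green data_neg i.
  rewrite -esum_kill_prob; last exact: data_neg_ge0.
  apply: eq_esum => j _; rewrite funenegE /= -EFin_max; congr EFin.
  by rewrite /data_neg maxr_pMr ?kill_prob_ge0 // mulr0 mulrN.
rewrite fineB //.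
- by apply: (green_fin_num hN halpha0 halpha1 hrho hp _ data_pos_ge0 esum_weight_data_pos).
- by apply: (green_fin_num hN halpha0 halpha1 hrho hp _ data_neg_ge0 esum_weight_data_neg).
Qed.

Lemma kernel_average_solves : solves alpha p data kernel_average.
Proof.
move=> i; rewrite (_ : kernel_average = fun j =>
  fine (green data_pos j) - fine (green data_neg j))%R; last first.
  by apply/funext => j; exact: kernel_averageE.
rewrite stepB.
rewrite (greenE hN halpha0 halpha1 hrho hp _ data_pos_ge0 esum_weight_data_pos).
rewrite (greenE hN halpha0 halpha1 hrho hp _ data_neg_ge0 esum_weight_data_neg).
by rewrite -[data i]data_posBneg; ring.
Qed.

Lemma kernel_average_in_X : in_X N alpha rho kernel_average.
Proof.
rewrite /in_X /=.
have Gp0 i := green_ge0 halpha0 halpha1 hp i data_pos_ge0.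
have Gn0 i := green_ge0 halpha0 halpha1 hp i data_neg_ge0.
have Gpf i := green_fin_num hN halpha0 halpha1 hrho hp i data_pos_ge0 esum_weight_data_pos.
have Gnf i := green_fin_num hN halpha0 halpha1 hrho hp i data_neg_ge0 esum_weight_data_neg.
have w0 i : (0 <= weight i)%R by rewrite ltW // weight_gt0.
apply: (@le_lt_trans _ _ (\esum_(i in [set: site d]) ((weight i)%:E * green data_pos i) +
   \esum_(i in [set: site d]) ((weight i)%:E * green data_neg i))); last first.
  apply: lte_add_pinfty; apply: (esum_weight_green_lty hN halpha0 halpha1 hrho hp).
  - exact: data_pos_ge0.
  - exact: esum_weight_data_pos.
  - exact: data_neg_ge0.
  - exact: esum_weight_data_neg.
rewrite -esumD; [|by move=> i _; rewrite mule_ge0 ?lee_fin..].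
apply: le_esum => i _; rewrite kernel_averageE -/(weight i).
rewrite -(fineK (Gpf i)) -(fineK (Gnf i)) -!EFinM -EFinD lee_fin -mulrDr [leLHS]mulrC.
rewrite /= ler_pM2l ?weight_gt0 //; apply: le_trans (ler_normB _ _) _.
by rewrite !ger0_norm // fine_ge0.
Qed.

End kernel_average.

(** * The Hamiltonian *)

Section splicing.
Context (R : realType) (d : nat) (L : {fset (site d)}).
Implicit Types (x y : configuration d R) (u : L -> R).

Lemma spliceE u y (k : L) : splice u y (val k) = u k.
Proof. by rewrite /splice valK. Qed.

Lemma splice_out u y i : i \notin L -> splice u y i = y i.
Proof. by move=> iL; rewrite /splice insubN. Qed.

Lemma splice_restrict x y :
  (forall i, i \notin L -> x i = y i) -> splice (restrict_to (L := L) x) y = x.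
Proof.
move=> xy; apply/funext => i; rewrite /splice; case: insubP => [k kL ki|iL].
  by rewrite /restrict_to ki.
by rewrite xy.
Qed.

Lemma restrict_splice u y : restrict_to (L := L) (splice u y) = u.
Proof. by apply/funext => k; rewrite /restrict_to spliceE. Qed.

End splicing.

Section hamiltonian_expansion.
Context (R : realType) (d : nat) (N : 'rV[R]_d -> R).
Context (alpha rho : R) (p : site d -> site d -> R) (data : configuration d R).
Hypotheses (hN : is_norm N) (halpha0 : 0 < alpha) (halpha1 : alpha < 1).
Hypotheses (hrho : 0 < rho) (hp : is_jump_matrix N rho p).
Implicit Types (L : {fset (site d)}) (x y h : configuration d R).

Local Notation step := (step alpha p).
Local Notation H := (hamiltonian alpha p data).

(** Carrying the condition that the bond touches L in the coefficient allows free, symmetric double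
    sums over a and b. *)
Definition bond L a b : R := if (a \in L) || (b \in L) then alpha * p a b else 0.

Lemma bondC L a b : bond L a b = bond L b a.
Proof. by rewrite /bond orbC (jump_symmetric hp). Qed.

Lemma bond_ge0 L a b : 0 <= bond L a b.
Proof. by rewrite /bond; case: ifP => // _; rewrite mulr_ge0 ?(jump_ge0 hp) // ltW. Qed.

(** A finite set containing both ends of every bond of nonzero weight that touches L. *)
Definition neighbourhood L : {fset (site d)} :=
  (L `|` [fset (l + k)%R | l in L, k in jump_support p])%fset.

Lemma neighbourhood_jump L a b : a \in L -> p a b != 0 -> b \in neighbourhood L.
Proof.
move=> aL pab; rewrite in_fsetU; apply/orP; right; apply/imfset2P.
exists a => //; exists (b - a); last by rewrite addrC subrK.
by rewrite /= (mem_jump_support hN hp) -(jump_diff hp).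
Qed.

Lemma sub_neighbourhood L a : a \in L -> a \in neighbourhood L.
Proof. by move=> aL; rewrite in_fsetU aL. Qed.

Definition bond_energy L x : R :=
  \sum_(a <- neighbourhood L) \sum_(b <- neighbourhood L)
    bond L a b * (x a - x b) ^+ 2.

Lemma bond_energy_ge0 L x : 0 <= bond_energy L x.
Proof.
apply: sumr_ge0 => a _; apply: sumr_ge0 => b _.
by rewrite mulr_ge0 ?bond_ge0 ?sqr_ge0.
Qed.

(* The Hamiltonian sums over an infinite set of pairs, of which only those
   within [neighbourhood L] contribute. *)
Lemma hamiltonianE L x :
  H L x = 2^-1 * bond_energy L x + (1 - alpha) * \sum_(i <- L) (x i - data i) ^+ 2.
Proof.
rewrite /hamiltonian; congr (_ * _ + _).
pose F (e : site d * site d) := bond L e.1 e.2 * (x e.1 - x e.2) ^+ 2.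
pose r := [seq (a, b) | a <- neighbourhood L, b <- neighbourhood L].
have ur : uniq r by rewrite allpairs_uniq ?fset_uniq // => -[? ?] [? ?].
transitivity (\sum_(e \in setT) F e).
  rewrite fsbig_mkcond; apply: eq_fsbigr => e _; rewrite patchE /F /bond.
  case: ifPn => [/set_mem /= -> //|/negP eL].
  by rewrite ifN ?mul0r //; apply/negP => eL'; apply: eL; exact: mem_set.
rewrite -(@fsbig_widen _ _ _ _ [set` r] setT) //; last first.
  move=> [a b] [_ /= abr]; rewrite /F /bond /=; case: ifP => [abL|]; last by rewrite mul0r.
  have [->|pab] := eqVneq (p a b) 0; first by rewrite mulr0 mul0r.
  case: abr; apply/allpairsP; exists (a, b) => /=.
  case/orP: abL => [aL|bL]; split => //.
  - exact: sub_neighbourhood.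
  - exact: neighbourhood_jump pab.
  - by apply: (neighbourhood_jump bL); rewrite (jump_symmetric hp).
  - exact: sub_neighbourhood.
by rewrite -fsbig_seq // big_allpairs.
Qed.

(** Summation by parts. Exchanging a and b makes the terms in h a and in - h b equal, whence the
    factor 2; as h vanishes off L, only sites of L remain, and all their bonds are counted. *)
Lemma bond_energy_linear L x h : (forall i, i \notin L -> h i = 0) ->
  \sum_(a <- neighbourhood L) \sum_(b <- neighbourhood L)
    bond L a b * (x a - x b) * (h a - h b) =
  2 * \sum_(i <- L) h i * (alpha * x i - step x i).
Proof.
move=> hL.
have sumL : \sum_(a <- neighbourhood L) \sum_(b <- neighbourhood L)
    bond L a b * (x a - x b) * h a = \sum_(i <- L) h i * (alpha * x i - step x i).
  rewrite -(@big_fset_incl _ _ _ _ L); first last.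
  - by move=> a _ aL; rewrite big1 // => b _; rewrite hL // mulr0.
  - by apply/fsubsetP => a; exact: sub_neighbourhood.
  rewrite big_seq [RHS]big_seq; apply: eq_bigr => a aL.
  have JT k : k \in jump_support p -> a + k \in neighbourhood L.
    by move=> kJ; apply: neighbourhood_jump aL _; rewrite (jump_homogeneous hp)
      -(mem_jump_support hN hp).
  (* The jumps from a have total mass 1 on the neighbourhood, so [alpha * x a] can be put under the
     sum over b. *)
  have := @sum_jump_reindex _ _ _ _ _ hN hp _ a (fun=> 1) JT.
  under [in X in _ = X -> _]eq_bigr do rewrite mulr1.
  rewrite (sum_jump hN hp) => sum1.
  rewrite /step -(sum_jump_reindex hN hp x JT) -[x a in RHS]mulr1 -sum1.
  rewrite -mulrBr !mulr_sumr -sumrB !mulr_sumr; apply: eq_bigr => b _.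
  by rewrite /bond aL /=; ring.
rewrite [LHS](_ : _ = \sum_(a <- neighbourhood L) \sum_(b <- neighbourhood L)
    bond L a b * (x a - x b) * h a + \sum_(a <- neighbourhood L)
    \sum_(b <- neighbourhood L) bond L b a * (x b - x a) * h b); last first.
  rewrite -big_split /=; apply: eq_bigr => a _; rewrite -big_split /=.
  by apply: eq_bigr => b _; rewrite (bondC L b); ring.
by rewrite [X in _ + X]exchange_big /= sumL; ring.
Qed.

(** The energy is quadratic, so its second-order expansion is exact. The linear coefficient at i is
    the residual of the Euler-Lagrange equation. *)
Lemma hamiltonianD L x h : (forall i, i \notin L -> h i = 0) ->
  H L (fun i => x i + h i) = H L x +
    2 * \sum_(i <- L) h i * (x i - ((1 - alpha) * data i + step x i)) +
    (2^-1 * bond_energy L h + (1 - alpha) * \sum_(i <- L) h i ^+ 2).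
Proof.
move=> hL; rewrite !hamiltonianE.
have -> : bond_energy L (fun i => x i + h i) = bond_energy L x + bond_energy L h +
    2 * (2 * \sum_(i <- L) h i * (alpha * x i - step x i)).
  rewrite -bond_energy_linear // /bond_energy mulr_sumr -!big_split /=.
  apply: eq_bigr => a _; rewrite mulr_sumr -!big_split /=.
  by apply: eq_bigr => b _; ring.
have -> : \sum_(i <- L) (x i + h i - data i) ^+ 2 = \sum_(i <- L) (x i - data i) ^+ 2 +
    \sum_(i <- L) h i ^+ 2 + 2 * \sum_(i <- L) h i * (x i - data i).
  rewrite mulr_sumr -!big_split /=; apply: eq_bigr => i _; ring.
have -> : \sum_(i <- L) h i * (x i - ((1 - alpha) * data i + step x i)) =
    \sum_(i <- L) h i * (alpha * x i - step x i) +
    (1 - alpha) * \sum_(i <- L) h i * (x i - data i).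
  rewrite mulr_sumr -!big_split /=; apply: eq_bigr => i _; ring.
by field.
Qed.

(** The linear term vanishes, and strictness comes from the data term (1 - alpha) sum h^2, to which
    the bonds add a nonnegative amount. *)
Lemma hamiltonian_lt L x x' :
  (forall i, i \in L -> x i = (1 - alpha) * data i + step x i) ->
  (forall i, i \notin L -> x' i = x i) -> x' <> x -> H L x < H L x'.
Proof.
move=> xS xx' xneq; pose h i := x' i - x i.
have hL i : i \notin L -> h i = 0 by move=> iL; rewrite /h xx' // subrr.
have -> : x' = fun i => x i + h i by apply/funext => i; rewrite /h addrC subrK.
rewrite hamiltonianD // [X in 2 * X]big1_seq; last first.
  by move=> i /= iL; rewrite {1}xS // subrr mulr0.
rewrite mulr0 addr0 ltrDl ltr_wpDl //; first by rewrite mulr_ge0 ?bond_energy_ge0 ?invr_ge0.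
rewrite mulr_gt0 ?subr_gt0 //.
have h2 i : 0 <= h i ^+ 2 by exact: sqr_ge0.
rewrite lt_neqAle sumr_ge0 // andbT eq_sym psumr_eq0 //.
apply/negP => /allP h0; apply: xneq; apply/funext => i; apply/eqP; rewrite -subr_eq0.
have [iL|iL] := boolP (i \in L); last by rewrite -/(h i) hL.
by have := h0 i iL; rewrite /= sqrf_eq0.
Qed.

Lemma solves_minimizes x : solves alpha p data x -> minimizes_hamiltonian alpha p data x.
Proof.
move=> xS x' L xneq x'L; rewrite /hamiltonian_diff subr_gt0.
have x'x i : i \notin L -> x' i = x i.
  by move=> iL; have [//|/x'L] := pselect (x' i = x i); rewrite (negPf iL).
by rewrite !splice_restrict //; apply: hamiltonian_lt => // i _; exact: xS.
Qed.

(** [get] chooses some minimizer; the strict inequality leaves only one to choose. The equation is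
    asked on L only, so that the lemma also serves configurations that solve it on a single box. *)
Lemma local_minimizerE L x y :
  (forall i, i \in L -> x i = (1 - alpha) * data i + step x i) ->
  (forall i, i \notin L -> x i = y i) ->
  local_minimizer (L := L) alpha p data y = restrict_to (L := L) x.
Proof.
move=> xS xy; rewrite /local_minimizer.
set P := [set _ | _].
have xmin (u : L -> R) : splice u y <> x -> H L x < H L (splice u y).
  apply: (hamiltonian_lt xS) => i iL; rewrite splice_out //.
  by apply/esym; exact: xy.
have Px : P (restrict_to (L := L) x).
  rewrite /P /= => v; rewrite splice_restrict //.
  by have [->//|/xmin/ltW] := pselect (splice v y = x).
have /= /(_ (restrict_to (L := L) x)) := getI Px; rewrite splice_restrict // => le.
have [<-|/xmin] := pselect (splice (get P) y = x); first by rewrite restrict_splice.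
by rewrite ltNge le.
Qed.

End hamiltonian_expansion.

(** * Ground states *)

Section countable_families.
Context dT (T : measurableType dT) (R : realType) (mu : measure T R).

Lemma negligible_bigcup_count (I : countType) (F : I -> set T) :
  (forall i, mu.-negligible (F i)) -> mu.-negligible (\bigcup_i F i).
Proof.
move=> F0; pose G k := oapp F set0 (choice.unpickle k).
apply: (@negligibleS _ _ _ _ (\bigcup_k G k)).
  by move=> x [i _ Fx]; exists (choice.pickle i) => //; rewrite /G choice.pickleK.
apply: negligible_bigcup => k; rewrite /G; case: choice.unpickle => [i|] //=.
exact: negligible_set0.
Qed.

Lemma measurable_bigcap_count (I : countType) (F : I -> set T) :
  (forall i, measurable (F i)) -> measurable (\bigcap_i F i).
Proof.
move=> mF; rewrite -[X in measurable X]setCK setC_bigcap; apply: measurableC.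
by apply: countable_bigcupT_measurable => // i; exact: measurableC.
Qed.

End countable_families.

(** * Measurability in the product space *)

Section coordinates.
Context {R : realType}.

Lemma measurable_coord (I : Type) (J : set I) (i : I) : J i ->
  measurable_fun setT (fun x : g_sigma_algebraType (@coord_events R I J) => x i).
Proof.
move=> Ji _ B mB; rewrite setTI; apply: sub_sigma_algebra.
by exists i => //; exists B.
Qed.

Lemma outside_measurable (d : nat) (L : {fset (site d)}) (B : set (configuration d R)) :
  measurable (B : set (outside_space L R)) ->
  measurable (B : set (prod_space (site d) R)).
Proof.
apply: sub_sigma_algebra2 => A [i _ [C mC ->]].
by exists i => //; exists C.
Qed.

Lemma measurable_config1 (d : nat) (m : configuration d R) :
  measurable ([set m] : set (prod_space (site d) R)).
Proof.
rewrite (_ : [set m] = \bigcap_i [set x | x i = m i]); last first.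
  apply/seteqP; split => x /=; first by move=> ->.
  by move=> xm; apply/funext => i; exact: xm.
apply: measurable_bigcap_count => i.
have := @measurable_coord (site d) setT i I measurableT [set m i] (measurable_set1 _).
by rewrite setTI.
Qed.

Lemma esum_le_fset (T : choiceType) (a : T -> R) (M : R) : (forall i, 0 <= a i) ->
  (\esum_(i in [set: T]) (a i)%:E <= M%:E)%E <->
  forall s : {fset T}, \sum_(i <- s) a i <= M.
Proof.
move=> a0; split => [aM s|sM].
  rewrite -lee_fin; apply: le_trans aM; apply: esum_ge; exists [set` s] => //.
  by rewrite -fsbig_seq ?fset_uniq // sumEFin.
apply: ge_ereal_sup => _ [X [fX _] <-].
by rewrite fsbig_finite // sumEFin lee_fin.
Qed.

(** A nonnegative family is summable when some integer bounds all its finite partial sums; integers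
    and finite sets of sites are countable in number. *)
Lemma measurable_in_X (d : nat) (N : 'rV[R]_d -> R) (alpha rho : R) :
  measurable (in_X N alpha rho : set (prod_space (site d) R)).
Proof.
pose a (x : configuration d R) j := `|x j| * alpha `^ (site_norm N j / rho).
have a0 x j : 0 <= a x j by rewrite mulr_ge0 ?powR_ge0.
rewrite (_ : in_X N alpha rho = \bigcup_(M : nat)
  \bigcap_(s : {fset (site d)}) [set x | \sum_(j <- s) a x j <= M%:R]); last first.
  apply/seteqP; split => x.
    rewrite /in_X /= -/(a x); set r := esum _ _ => rfin.
    have r0 : (0 <= r)%E by apply: esum_ge0 => j _; rewrite lee_fin; exact: a0.
    have rf : r \is a fin_num by rewrite ge0_fin_numE.
    exists (Num.truncn (fine r)).+1 => // s _ /=.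
    have /esum_le_fset : (r <= (Num.truncn (fine r)).+1%:R%:E)%E.
      by rewrite -(fineK rf) lee_fin ltW // truncnS_gt.
    by apply; exact: a0.
  case=> M _ xM; rewrite /in_X /=; apply: le_lt_trans (ltry M%:R).
  by apply/(esum_le_fset _ (a0 x)) => s; exact: xM.
apply: bigcupT_measurable => M; apply: measurable_bigcap_count => s.
have mf : measurable_fun setT
    (fun x : prod_space (site d) R => \sum_(j <- s) a x j).
  apply: measurable_sum => j; apply: measurable_funM => //.
  by apply: measurableT_comp => //; exact: measurable_coord.
have := mf measurableT `]-oo, M%:R]%classic (measurable_itv _).
rewrite setTI; congr measurable; apply/seteqP; split => x /=;
  by rewrite in_itv.
Qed.

End coordinates.

Lemma probability_dirac (R : realType) (d : nat)
    (mu : probability (prod_space (site d) R) R) (m : configuration d R) :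
  mu.-negligible (~` [set m]) ->
  forall A : set (prod_space (site d) R), measurable A ->
    mu A = (\d_(m : prod_space (site d) R) A)%E.
Proof.
move=> m0 A mA; rewrite diracE; have [Am|Am] := boolP (m \in A).
  rewrite -[in LHS](setCK A) probability_setC; last exact: measurableC.
  rewrite [X in (1 - X)%E](_ : _ = 0%E) ?sube0 //.
  apply: measure_negligible; first exact: measurableC.
  by apply: negligibleS m0 => x Ax /= xm; apply: Ax; rewrite xm; exact: set_mem.
apply: measure_negligible => //; apply: negligibleS m0 => x Ax /= xm.
by move: Am; rewrite -xm => /negP; apply; exact: mem_set.
Qed.

Section ground_state_properties.
Context (R : realType) (d : nat) (N : 'rV[R]_d -> R).
Context (alpha rho : R) (p : site d -> site d -> R) (data : configuration d R).
Hypotheses (hN : is_norm N) (halpha0 : 0 < alpha) (halpha1 : alpha < 1).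
Hypotheses (hrho : 0 < rho) (hp : is_jump_matrix N rho p).
Local Notation step := (step alpha p).
Local Notation Omega := (prod_space (site d) R).

(** The conditional law is the constant kernel at the restriction of m. It need agree with the
    specification at y = m only, the other configurations forming a null set. *)
Lemma dirac_is_ground_state (m : configuration d R) :
  in_X N alpha rho m -> solves alpha p data m ->
  is_ground_state N alpha rho p data (\d_(m : Omega)).
Proof.
move=> mX mS; split; first by rewrite /= diracE mem_set.
move=> L; pose r : prod_space L R := restrict_to (L := L) m.
have mr : measurable_fun [set: outside_space L R] (fun=> r) by exact: measurable_cst.
exists (kdirac mr).
  move=> A B mA mB; rewrite [RHS](_ : _ = (\int[\d_(m : Omega)]_(y in B) cst (\d_r A) y)%E) //.
  rewrite integral_cst; last exact: outside_measurable mB.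
  rewrite !diracE -EFinM -natrM mulnb; congr (_%:R%:E).
  by congr nat_of_bool; rewrite in_setI; congr (_ && _); apply/idP/idP;
    rewrite !inE.
exists (~` [set m]); split.
- by apply: measurableC; exact: measurable_config1.
- suff : (\d_(m : Omega) (~` [set m]) = 0 :> \bar R)%E by [].
  by rewrite diracE memNset //= => /(_ erefl).
- move=> y /= Py ym; apply: Py => A mA; rewrite ym /zero_temp_spec /kdirac.
  by rewrite (local_minimizerE hN halpha0 halpha1 hp (x := m)).
Qed.

(** Since p(0,0) = 0, changing y at i leaves [step y i] unchanged, so setting the value at i to the
    right-hand side solves the equation there. *)
Lemma local_minimizer_singleton (y : configuration d R) i (k : [fset i]%fset) :
  p 0 0 = 0 ->
  local_minimizer (L := [fset i]%fset) alpha p data y k =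
    (1 - alpha) * data i + step y i.
Proof.
move=> p00; pose z j := if j == i then (1 - alpha) * data i + step y i else y j.
have ki : val k = i by apply/fset1P; exact: valP.
rewrite (local_minimizerE hN halpha0 halpha1 hp (x := z)); first last.
- by move=> j; rewrite inE /z => /negPf ->.
- move=> j; rewrite inE => /eqP ->; rewrite {1}/z eqxx; congr (_ + _ * _).
  rewrite big_seq [RHS]big_seq; apply: eq_bigr => l; rewrite (mem_jump_support hN hp) => pl.
  congr (_ * _); rewrite /z -subr_eq0 addrAC subrr add0r ifN //.
  by apply: contra pl => /eqP ->; rewrite p00.
by rewrite /restrict_to ki /z eqxx.
Qed.

Lemma measurable_step_config (i : site d) (L : {fset (site d)}) :
  (forall k, k \in jump_support p -> i + k \notin L) ->
  measurable_fun setT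
    (fun y : outside_space L R => (1 - alpha) * data i + step y i).
Proof.
move=> iL; pose F (y : outside_space L R) : R :=
  \sum_(k <- jump_support p) (if k \in jump_support p then p 0 k * y (i + k) else 0).
apply: measurable_funD => //; apply: measurable_funM => //.
apply: (@eq_measurable_fun _ _ _ _ setT F).
  move=> y _ /=; rewrite /F big_seq [RHS]big_seq; apply: eq_bigr => k kJ.
  by rewrite kJ.
apply: measurable_sum => k.
have [kJ|_] := boolP (k \in jump_support p); last exact: measurable_cst.
apply: measurable_funM => //; apply: measurable_coord; exact: iL.
Qed.

(* Off the box {i} the event [~ A (v x)], with [v] the minimizer in the box, is
   determined by the outside configuration, and given it [x i = v x] is not in [A]. *)
Lemma ground_state_disagree (mu : probability Omega R) i (A : set R) :
  p 0 0 = 0 -> is_ground_state N alpha rho p data mu -> measurable A ->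
  mu.-negligible [set x : Omega | A (x i) /\ ~ A ((1 - alpha) * data i + step x i)].
Proof.
move=> p00 [_ gs] mA.
have [kappa cond ae] := gs [fset i]%fset.
pose k0 : [fset i]%fset := [` fset11 i]%fset.
pose v (y : configuration d R) := (1 - alpha) * data i + step y i.
pose A' : set (prod_space [fset i]%fset R) := [set u | A (u k0)].
pose B : set (outside_space [fset i]%fset R) := [set y | ~ A (v y)].
have mA' : measurable A'.
  have := @measurable_coord R _ setT k0 I measurableT A mA.
  by rewrite setTI.
have mB : measurable B.
  have mv := @measurable_step_config i [fset i]%fset.
  have := mv _ measurableT (~` A) (measurableC mA); rewrite setTI; apply.
  move=> k; rewrite (mem_jump_support hN hp) inE => pk.
  by rewrite -subr_eq0 addrAC subrr add0r; apply: contra pk => /eqP ->; rewrite p00.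
apply/negligibleP.
  apply: measurableI; last exact: outside_measurable mB.
  by have := @measurable_coord R _ setT i I measurableT A mA; rewrite setTI.
apply: (etrans (cond A' B mA' mB)).
rewrite (@ae_eq_integral _ _ _ mu B (cst 0%E) (fun y => kappa y A')).
- by rewrite integral0.
- exact: outside_measurable mB.
- apply: measurable_funTS => _ C mC; apply: outside_measurable.
  exact: (measurable_kernel kappa A' mA' measurableT C mC).
- exact: measurable_cst.
- apply: negligibleS ae => y; apply: contra_not => /(_ A' mA') E By; rewrite E.
  rewrite /zero_temp_spec diracE memNset //.
  by rewrite /A' /= local_minimizer_singleton.
Qed.

(** A conditional law only tests an event inside the box against an event outside. Two distinct
    reals are separated by a half-line with rational end, so countably many such tests suffice; both
    directions are needed for the two orders. *)
Lemma ground_state_solves (mu : probability Omega R) i :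
  p 0 0 = 0 -> is_ground_state N alpha rho p data mu ->
  mu.-negligible [set x : Omega | x i <> (1 - alpha) * data i + step x i].
Proof.
move=> p00 gs; pose v (y : configuration d R) := (1 - alpha) * data i + step y i.
pose E (q : rat) : set Omega :=
  [set x | `]-oo, ratr q[%classic (x i) /\ ~ `]-oo, ratr q[%classic (v x)] `|`
  [set x | `[ratr q, +oo[%classic (x i) /\ ~ `[ratr q, +oo[%classic (v x)].
apply: (@negligibleS _ _ _ _ (\bigcup_q E q)); last first.
  apply: negligible_bigcup_count => q; apply: negligibleU;
    exact: ground_state_disagree.
move=> x /= /eqP; rewrite neq_lt => /orP[] /rat_in_itvoo[q]; rewrite in_itv /= => /andP[qx qv].
  exists q => //; left; split => /=; first by rewrite in_itv.
  by rewrite in_itv /= => /(lt_trans qv); rewrite ltxx.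
exists q => //; right; split => /=; first by rewrite in_itv /= andbT ltW.
by rewrite in_itv /= andbT leNgt qx.
Qed.

Lemma ground_state_unique (mu : probability Omega R) (m : configuration d R) :
  p 0 0 = 0 -> in_X N alpha rho m -> solves alpha p data m ->
  is_ground_state N alpha rho p data mu ->
  forall A : set Omega, measurable A -> mu A = (\d_(m : Omega) A)%E.
Proof.
move=> p00 mX mS gs; apply: probability_dirac.
have nX : mu.-negligible (~` in_X N alpha rho).
  have mXs := measurable_in_X N alpha rho.
  apply/negligibleP; first exact: measurableC.
  by apply: (etrans (probability_setC mu mXs)); rewrite gs.1 subee.
have nS : mu.-negligible
    (\bigcup_i [set x : Omega | x i <> (1 - alpha) * data i + step x i]).
  by apply: negligible_bigcup_count => i; exact: ground_state_solves.
apply: negligibleS (negligibleU nX nS) => x /= xm.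
have [xX|] := pselect (in_X N alpha rho x); last by left.
right; apply: contrapT => xS; apply: xm.
apply: (solves_unique hN halpha0 halpha1 hrho hp xX mX _ mS) => i.
by apply: contrapT => xi; apply: xS; exists i.
Qed.

End ground_state_properties.

Theorem theorem2p3 (R : realType) (d : nat) (N : 'rV[R]_d -> R)
    (alpha rho : R) (p : site d -> site d -> R) (data : configuration d R)
    (dW : measure_display) (W : measurableType dW)
    (Pr : site d -> probability W R) (Y : nat -> W -> option (site d))
    (S : nat -> W -> \bar R)
    (hd : (1 <= d)%N) (hN : is_norm N)
    (halpha0 : 0 < alpha) (halpha1 : alpha < 1) (hrho : 0 < rho)
    (hp : is_jump_matrix N rho p)
    (hwalk : is_killed_walk alpha p Pr Y S)
    (hp00 : p 0 0 = 0) (hdata : in_X N alpha rho data) :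
  let m : configuration d R :=
    fun i => family_sum (fun j => kill_prob Pr Y S i j * data j) in
  (forall i, summable [set: site d]
     (fun j => (kill_prob Pr Y S i j * data j)%:E)) /\
  minimizes_hamiltonian alpha p data m /\
  is_ground_state N alpha rho p data (\d_(m : prod_space (site d) R)) /\
  (forall mu : probability (prod_space (site d) R) R,
     is_ground_state N alpha rho p data mu ->
     forall A : set (prod_space (site d) R), measurable A ->
       mu A = \d_(m : prod_space (site d) R) A).
Proof.
have mS := kernel_average_solves hN halpha0 halpha1 hrho hp hwalk hdata.
have mX := kernel_average_in_X hN halpha0 halpha1 hrho hp hwalk hdata.
split; first by move=> i; exact: (kill_prob_summable hN halpha0 halpha1 hrho hp hwalk hdata).
split; first exact: (solves_minimizes hN halpha0 halpha1 hp mS).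
split; first exact: (dirac_is_ground_state hN halpha0 halpha1 hp mX mS).
move=> mu gs; exact: (ground_state_unique hN halpha0 halpha1 hrho hp hp00 mX mS gs).
Qed.
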